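(* Fix a prime $p>2$ and a nontrivial additive character $\psi:\mathbb{F}_p\to\mathbb{C}^\times$. Let $\Phi\in\mathcal{S}(\mathbb{R})$ be a fixed Schwartz function whose Fourier transform $\hat\Phi$ is supported in $|\tau|<1-1/p$. Then $$\lim_{d\to\infty,\ (d,2p)=1}\ \big\langle W_1(f,\psi,\Phi)\big\rangle_{f\in\mathcal{AS}_d^{0,\mathrm{odd}}}=\int_{-\infty}^\infty\Phi(t)\left(1-\frac{\sin 2\pi t}{2\pi t}\right)\mathrm{d}t,$$ uniformly in $q$ (i.e. for every $\varepsilon>0$ there is $d_0$ such that for all powers $q$ of $p$ and all $d\ge d_0$ with $(d,2p)=1$ the two sides differ by less than $\varepsilon$).
   Context: $q$ denotes a power of $p$, $\mathbb{F}_q$ the field with $q$ elements, $\mathrm{tr}_{q^r/p}:\mathbb{F}_{q^r}\to\mathbb{F}_p$ the trace map. For $f\in\mathbb{F}_q(x)\setminus\mathbb{F}_q$ not of the form $h^p-h$, $h\in\mathbb{F}_q(x)$, define $$L(u,f,\psi)=\exp\Big(\sum_{r\ge1}\frac{u^r}{r}\sum_{\alpha\in\mathbb{F}_{q^r}\cup\{\infty\},\ f(\alpha)\neq\infty}\psi(\mathrm{tr}_{q^r/p}f(\alpha))\Big),$$ known to be a polynomial in $u$ of degree $N=2\mathfrak{g}(C_f)/(p-1)$ ($C_f$ the smooth projective model of $y^p-y=f(x)$) with all roots of absolute value $q^{-1/2}$; write $L(u,f,\psi)=\prod_{i=1}^N(1-q^{1/2}\rho_i u)$, $|\rho_i|=1$,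 $\theta_i=\arg(\rho_i)/2\pi\in\mathbb{R}/\mathbb{Z}$. For $(d,p)=1$, $\mathcal{AS}_d^0=\{f=\sum_{i=0}^d a_ix^i\in\mathbb{F}_q[x]: a_d\ne0,\ a_i=0 \text{ whenever } i>0,\ p\mid i\}$, and for $(d,2p)=1$, $\mathcal{AS}_d^{0,\mathrm{odd}}=\{f\in\mathcal{AS}_d^0: f(-x)=-f(x)\}$; for these $f$, $N=d-1$. For $\Phi\in\mathcal S(\mathbb{R})$, $\phi_N(t)=\sum_{n\in\mathbb{Z}}\Phi(N(t+n))$ and $W_1(f,\psi,\Phi)=\sum_{i=1}^N\phi_N(\theta_i)$. $\langle\cdot\rangle_{f\in S}$ is the uniform average over a finite set $S$. $\hat\Phi(\tau)=\int\Phi(t)e^{-2\pi i\tau t}\mathrm dt$. *)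

(* Defs.v *)
From HB Require Import structures.
From mathcomp Require Import all_boot all_order all_algebra all_field.
From mathcomp Require Import all_classical all_reals all_analysis.
From mathcomp Require Import complex.

Set Implicit Arguments.
Unset Strict Implicit.
Unset Printing Implicit Defensive.

Import Order.TTheory GRing.Theory Num.Theory.
Import numFieldNormedType.Exports.
Local Open Scope classical_set_scope.
Local Open Scope ring_scope.

(* Analytic side.  A Schwartz function Phi : R -> C is given by its   *)
(* real part Phir and imaginary part Phii.                             *)

Definition schwartz (R : realType) (f : R -> R) : Prop :=
  (forall (n : nat) (x : R), derivable (derive1n n f) x 1) /\
  (forall m n : nat, exists M : R, forall x : R, `|x ^+ m * derive1n n f x| <= M).

(** Fourier transform hat Phi(tau) = int Phi(t) e^{-2 pi i tau t} dt of
    Phi = Phir + i Phii: real and imaginary parts. *)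
Definition fourier_re (R : realType) (Phir Phii : R -> R) (tau : R) : R :=
  \int[lebesgue_measure]_(t in [set: R])
     (Phir t * cos (2 * pi * tau * t) + Phii t * sin (2 * pi * tau * t)).

Definition fourier_im (R : realType) (Phir Phii : R -> R) (tau : R) : R :=
  \int[lebesgue_measure]_(t in [set: R])
     (Phii t * cos (2 * pi * tau * t) - Phir t * sin (2 * pi * tau * t)).

Definition sumZ (R : realType) (g : int -> R) : R :=
  limn (series (fun n : nat => g n%:Z)) +
  limn (series (fun n : nat => g (- (n.+1)%:Z))).

Definition periodize (R : realType) (Phir Phii : R -> R) (N : nat) (t : R)
  : R[i] :=
  (sumZ (fun n : int => Phir (N%:R * (t + n%:~R))) +i*
   sumZ (fun n : int => Phii (N%:R * (t + n%:~R))))%C.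

(** the kernel 1 - sin(2 pi t)/(2 pi t) (value at the removable point t = 0
    taken to be its limit 0; irrelevant for the integral). *)
Definition sinc_kernel (R : realType) (t : R) : R :=
  if t == 0 then 0 else 1 - sin (2 * pi * t) / (2 * pi * t).

Definition sinc_integral (R : realType) (Phir Phii : R -> R) : R[i] :=
  ((\int[lebesgue_measure]_(t in [set: R]) (Phir t * sinc_kernel t)) +i*
   (\int[lebesgue_measure]_(t in [set: R]) (Phii t * sinc_kernel t)))%C.

Definition expi (R : realType) (theta : R) : R[i] :=
  (cos (2 * pi * theta) +i* sin (2 * pi * theta))%C.

(** absolute trace tr_{E/F_p}(x) = sum_{j < [E:F_p]} x^(p^j), for E a finite
    field of characteristic p (so #|E| = p^(logn p #|E|)). *)
Definition trFp (p : nat) (E : finFieldType) (x : E) : E :=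
  \sum_(j < logn p #|E|) x ^+ (p ^ j).

(** identification of the prime subfield of E with 'F_p: the unique
    k in 'F_p with k%:R = y (when y lies in the prime field). *)
Definition toFp (p : nat) (E : finFieldType) (y : E) : 'F_p :=
  odflt 0 [pick k : 'F_p | ((nat_of_ord k)%:R == y)].

Definition ASpoly (F : finFieldType) (d : nat) (c : {ffun 'I_d.+1 -> F})
  : {poly F} := \poly_(i < d.+1) c (inord i).

Definition AS0odd (p : nat) (F : finFieldType) (d : nat)
  : {set {ffun 'I_d.+1 -> F}} :=
  [set c : {ffun 'I_d.+1 -> F} | [&& c ord_max != 0,
              [forall i : 'I_d.+1, ((0 < i) && (p %| i))%N ==> (c i == 0)] &
              (ASpoly c \Po (- 'X) == - ASpoly c)]].

(** the character sum  sum_{alpha in E} psi(tr_{E/F_p} f(alpha)),  where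
    E is an extension of F (embedding iota) and f has coefficients in F.
    (For polynomial f, f(infinity) = infinity is excluded.) *)
Definition char_sum (R : realType) (p : nat) (F E : finFieldType)
  (iota : {rmorphism F -> E}) (psi : 'F_p -> R[i]) (f : {poly F}) : R[i] :=
  \sum_(a : E) psi (toFp p (trFp p (map_poly iota f).[a])).

Definition W1 (R : realType) (Phir Phii : R -> R) (N : nat) (theta : 'I_N -> R)
  : R[i] :=
  \sum_(i < N) periodize Phir Phii N (theta i).

(* Main.v *)
(* By Poisson summation the average of W_1 is a finite sum over r < N of the
   values hatPhi(r/N) against the averages over f of the r-th power sums of the
   angles, which are the character sums S_r(f) divided by -q^(r/2).  Averaging
   over a coefficient a_i, with i < d odd and prime to p, kills the contribution
   of alpha in F_(q^r) unless tr(alpha^i) = 0, so only the alpha all of whose odd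
   traces tr(alpha^i), i < d, vanish survive.  For even r the alpha with
   alpha^(q^(r/2)) = -alpha are among them and contribute 1 each, q^(r/2) in
   total, which produces the kernel 1 - sin(2 pi t)/(2 pi t) through the Riemann
   sum of hatPhi over even r.  The other surviving alpha of degree r have a
   minimal polynomial whose reciprocal P satisfies P(X)/P(-X) = g(X^p) modulo X^d,
   and counting the possible g shows that there are at most r q^(e + r - (d-1)/2)
   of them, e being the number of odd multiples of p below d; relative to q^(r/2)
   this is exponentially small in N - 2e - r.  As N - 2e = N(1 - 1/p) + O(1) is
   the edge of the support of hatPhi, where hatPhi vanishes to first order, the
   total error is O(1/N), uniformly in q. *)

(* The relation P(X)/P(-X) = g(X^p) ties g to its own inverse by g(X) g(-X) = 1, which is awkward to
   count. Writing 2 P = U + V with U even and V odd replaces the quotient by its Cayley transform w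
   = V/U, which is only required to be odd: a linear condition, counted coefficient by coefficient.
   Two elements with the same w modulo X^d need not be conjugate; the second factor q^(r - (d-1)/2)
   measures this ambiguity. The case V = 0, an orbit stable under negation, has to be set apart,
   because the even part U may then vanish nowhere useful: it is where the main term comes from.
   Poisson summation is obtained from the Fejer kernel. Since hatPhi vanishes beyond the edge, the
   partial sums of the Fourier side are eventually constant, so convergence of their Cesaro means
   already identifies them. The first order vanishing of hatPhi at the edge is a Lipschitz bound,
   due to the integrability of t Phi(t). Real and imaginary parts of Phi are treated separately,
   each inheriting the support condition by parity in tau. *)
Require Import Defs.
From HB Require Import structures.
From mathcomp Require Import all_boot all_order all_algebra all_field.
From mathcomp Require Import ring zify.

Set Implicit Arguments.
Unset Strict Implicit.
Unset Printing Implicit Defensive.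

Import Order.TTheory GRing.Theory Num.Theory.
Local Open Scope ring_scope.

(** * Even and odd parts of reciprocal polynomials, and power sums *)

Section PolyParity.
Variable K : fieldType.
Implicit Types (P Q U V : {poly K}) (s : seq K).

Lemma size_polyM_le P Q a b : (size P <= a -> size Q <= b -> size (P * Q)%R <= (a + b).-1)%N.
Proof.
move=> hP hQ; apply: leq_trans (size_polyMleq _ _) _.
by rewrite -!subn1 leq_sub2r // leq_add.
Qed.

Definition polyN P : {poly K} := P \Po (- 'X).

Lemma polyN_is_zmod_morphism : zmod_morphism polyN.
Proof. by move=> P Q; rewrite /polyN raddfB. Qed.

Lemma polyN_is_monoid_morphism : monoid_morphism polyN.
Proof. by split=> [|P Q]; rewrite /polyN ?rmorphM // comp_polyC. Qed.

HB.instance Definition _ := GRing.isZmodMorphism.Build _ _ polyN polyN_is_zmod_morphism.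
HB.instance Definition _ := GRing.isMonoidMorphism.Build _ _ polyN polyN_is_monoid_morphism.

Lemma coef_polyN P i : (polyN P)`_i = (-1) ^+ i * P`_i.
Proof.
rewrite /polyN comp_polyE coef_sum.
have E j : (P`_j *: (- 'X) ^+ j)`_i = (if i == j then (-1) ^+ i * P`_i else 0).
  have -> : (- 'X) ^+ j = ((-1) ^+ j)%:P * 'X^j :> {poly K}.
    by rewrite [LHS]exprNn rmorphXn rmorphN rmorph1.
  rewrite coefZ coefCM coefXn.
  by case: eqP => [->|_]; rewrite ?mulr0 // mulr1 mulrC.
under eq_bigr do rewrite E.
have [lt_i|le_i] := ltnP i (size P).
  rewrite (bigD1 (Ordinal lt_i)) //= eqxx big1 ?addr0 // => j /eqP nj.
  by case: eqP => // e; case: nj; apply: val_inj.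
rewrite nth_default // mulr0 big1 // => j _.
by case: ifP.
Qed.

Lemma size_polyN P : (size (polyN P) <= size P)%N.
Proof. by apply/leq_sizeP => j hj; rewrite coef_polyN nth_default // mulr0. Qed.

Lemma polyNX : polyN 'X = - 'X.
Proof. by rewrite /polyN comp_polyX. Qed.

Lemma polyNK P : polyN (polyN P) = P.
Proof. by apply/polyP => i; rewrite !coef_polyN mulrA -exprMn mulrN1 opprK expr1n mul1r. Qed.

Lemma dvdp_XnN n P : ('X^n %| P) -> 'X^n %| polyN P.
Proof.
case/dvdpP => Q ->; rewrite rmorphM /= rmorphXn /= polyNX exprNn mulrA.
exact: dvdp_mull.
Qed.

Lemma deriv_polyN P : (polyN P)^`() = - polyN (P^`()).
Proof. by rewrite /polyN deriv_comp derivN derivX mulrN1. Qed.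

Definition revprod s : {poly K} := \prod_(a <- s) (1 - a *: 'X).
(** Twice the even part and, next, twice the odd part: leaving out the factor 1/2 delays the
    hypothesis that 2 is invertible. *)
Definition evenp s := revprod s + polyN (revprod s).
Definition oddp s := revprod s - polyN (revprod s).
Definition psum (i : nat) s : K := \sum_(a <- s) a ^+ i.

Lemma size_revprod s : (size (revprod s) <= (size s).+1)%N.
Proof.
elim: s => [|a s IH]; rewrite /revprod ?big_nil ?size_polyC ?oner_eq0 // big_cons.
apply: (size_polyM_le (a := 2)) IH.
apply: leq_trans (size_polyD _ _) _.
rewrite poly.size_polyN geq_max size_polyC oner_eq0 /=.
by apply: leq_trans (size_scale_leq _ _) _; rewrite size_polyX.
Qed.

Lemma size_evenp s : (size (evenp s) <= (size s).+1)%N.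
Proof.
apply: leq_trans (size_polyD _ _) _; rewrite geq_max size_revprod.
exact: leq_trans (size_polyN _) (size_revprod _).
Qed.

Lemma size_oddp s : (size (oddp s) <= (size s).+1)%N.
Proof.
apply: leq_trans (size_polyD _ _) _; rewrite geq_max size_revprod poly.size_polyN.
exact: leq_trans (size_polyN _) (size_revprod _).
Qed.

Lemma revprod0 s : (revprod s).[0] = 1.
Proof.
rewrite /revprod horner_prod big1 // => a _.
by rewrite hornerD hornerN hornerZ hornerX hornerC mulr0 subr0.
Qed.

Lemma polyN0 P : (polyN P).[0] = P.[0].
Proof. by rewrite /polyN horner_comp !hornerE oppr0. Qed.

Lemma evenp0 s : (evenp s).[0] = 2.
Proof. by rewrite /evenp hornerD polyN0 revprod0. Qed.

Lemma oddp0 s : (oddp s).[0] = 0.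
Proof. by rewrite /oddp hornerD hornerN polyN0 subrr. Qed.

Lemma polyN_evenp s : polyN (evenp s) = evenp s.
Proof. by rewrite /evenp rmorphD /= polyNK addrC. Qed.

Lemma polyN_oddp s : polyN (oddp s) = - oddp s.
Proof. by rewrite /oddp rmorphB /= polyNK opprB. Qed.

Lemma even_oddp s : evenp s + oddp s = revprod s *+ 2.
Proof. by rewrite /evenp /oddp addrACA subrr addr0 mulr2n. Qed.

Lemma root_revprod s a : a != 0 -> root (revprod s) a^-1 = (a \in s).
Proof.
move=> a0; rewrite /root /revprod horner_prod prodf_seq_eq0.
apply/hasP/idP => [[b bs /=]|ains]; last first.
  by exists a => //=; rewrite !hornerE mulfV // subrr.
rewrite !hornerE subr_eq0 => /eqP e.
suff -> : a = b by [].
by rewrite -[b](mulfK a0) mulrAC -e mul1r.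
Qed.

(* Newton's identities, as P'/P = - sum_i p_(i+1) X^i modulo X^n. *)
Lemma deriv_revprod s n : exists H,
  (revprod s)^`() = - (revprod s * \poly_(i < n) psum i.+1 s) + 'X^n * H.
Proof.
elim: s => [|a s [H IH]].
  exists 0; rewrite /revprod big_nil derivC mul1r mulr0 addr0.
  suff -> : \poly_(i < n) psum i.+1 [::] = 0 by rewrite oppr0.
  by apply/polyP => i; rewrite coef_poly coef0 /psum big_nil if_same.
have -> : revprod (a :: s) = (1 - a *: 'X) * revprod s by rewrite /revprod big_cons.
have -> : \poly_(i < n) psum i.+1 (a :: s)
   = \poly_(i < n) a ^+ i.+1 + \poly_(i < n) psum i.+1 s.
  apply/polyP => i; rewrite coefD !coef_poly; case: ifP => _; rewrite ?addr0 //.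
  by rewrite /psum big_cons.
have G : (1 - a *: 'X) * (\poly_(i < n) a ^+ i.+1) = a%:P - (a ^+ n.+1) *: 'X^n.
  elim: n {H IH} => [|n IHn].
    by rewrite poly_def big_ord0 mulr0 expr1 expr0 alg_polyC subrr.
  have -> : \poly_(i < n.+1) a ^+ i.+1 = \poly_(i < n) a ^+ i.+1 + a ^+ n.+1 *: 'X^n.
    by rewrite !poly_def big_ord_recr.
  rewrite mulrDr IHn mulrBl mul1r -scalerAl -scalerAr scalerA -exprS -exprS.
  by rewrite -addrA addKr.
rewrite derivM IH derivB derivC derivZ derivX sub0r alg_polyC.
exists ((1 - a *: 'X) * H - (a ^+ n.+1)%:P * revprod s).
have Ga : a%:P = (1 - a *: 'X) * (\poly_(i < n) a ^+ i.+1) + (a ^+ n.+1)%:P * 'X^n.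
  by rewrite G mul_polyC addrNK.
rewrite {1}Ga; ring.
Qed.

(** The index is shifted: the coefficient of X^i is the power sum of exponent i + 1, so the odd
    power sums sit at the even degrees. *)
Lemma polyN_psum s n : (forall i, (i <= n)%N -> odd i -> psum i s = 0) ->
  polyN (\poly_(i < n) psum i.+1 s) = - \poly_(i < n) psum i.+1 s.
Proof.
move=> h; apply/polyP => i; rewrite coef_polyN coefN coef_poly.
case: ifP => [lin|_]; last by rewrite mulr0 oppr0.
have [oi|ei] := boolP (odd i); last by rewrite h ?mulr0 ?oppr0 //=.
by rewrite -signr_odd oi expr1 mulN1r.
Qed.

(* The logarithmic derivatives of P and P(-X) agree to order n, being the
   generating series of the power sums, whose odd part vanishes. *)
Lemma evenp_oddp_wronskian s n : (forall i, (i <= n)%N -> odd i -> psum i s = 0) ->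
  'X^n %| (oddp s)^`() * evenp s - (evenp s)^`() * oddp s.
Proof.
move=> h; have [H E] := deriv_revprod s n.
set S := \poly_(i < n) _ in E.
have EN : (polyN (revprod s))^`()
   = - (polyN (revprod s) * S) - polyN ('X^n * H).
  rewrite deriv_polyN E rmorphD rmorphN rmorphM /= polyN_psum // -/S; ring.
have /dvdpP[H1 EH1] : 'X^n %| polyN ('X^n * H) by apply/dvdp_XnN/dvdp_mulr.
rewrite /oddp /evenp derivB derivD E EN EH1.
set P := revprod s; set Q := polyN _.
have -> : (- (P * S) + 'X^n * H - (- (Q * S) - H1 * 'X^n)) * (P + Q)
  - (- (P * S) + 'X^n * H + (- (Q * S) - H1 * 'X^n)) * (P - Q)
  = 'X^n * (2 * (H * Q + H1 * P)) by ring.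
exact: dvdp_mulr.
Qed.

Lemma small_dvdXn n P : 'X^n %| P -> (size P <= n)%N -> P = 0.
Proof.
move=> dv sz; apply/eqP; apply/negPn/negP => P0.
by have := leq_trans (dvdp_leq P0 dv) sz; rewrite size_polyXn ltnn.
Qed.

(** V vanishes at 0 by parity and at every a^-1, where U and U + V = 2 P both vanish: [size s] + 1
    zeros against a degree of at most [size s]. *)
Lemma oddp_eq0_roots s : uniq s -> 0 \notin s ->
  (forall a, a \in s -> (evenp s).[a^-1] = 0) -> oddp s = 0.
Proof.
move=> us s0 h; apply/eqP/negPn/negP => V0.
have inj : injective (@GRing.inv K) by exact: invr_inj.
have := @max_poly_roots _ (oddp s) (0 :: [seq a^-1 | a <- s]) V0.
rewrite /= /root oddp0 eqxx /= size_map (map_inj_uniq inj) us andbT.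
have -> : (0 \notin [seq a^-1 | a <- s]).
  by apply/mapP => -[a ains /eqP]; rewrite eq_sym invr_eq0 => /eqP a0; rewrite -a0 ains in s0.
move=> /(_ _ isT) H.
have : all (root (oddp s)) [seq a^-1 | a <- s].
  apply/allP => _ /mapP[a ains ->]; rewrite /root.
  have a0 : a != 0 by apply: contraNneq s0 => <-.
  have : (evenp s + oddp s).[a^-1] = 0.
    have := root_revprod s a0; rewrite ains => /rootP Pa.
    by rewrite even_oddp hornerMn Pa mul0rn.
  by rewrite hornerD h // add0r => ->.
by move=> /H /leq_trans /(_ (size_oddp s)); rewrite ltnn.
Qed.

(** The Wronskian V' U - U' V is divisible by X^n and too small, hence 0. In characteristic p this
    does not make V/U constant; instead, at a zero y of P one has V(y) = -U(y), so the Wronskian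
    reads U(y) (U + V)'(y) = 0, and as the zeros of U + V = 2 P are simple, U(y) = 0. *)
Lemma oddp_eq0_small s n : (2 : K) != 0 -> uniq s -> 0 \notin s ->
  (forall i, (i <= n)%N -> odd i -> psum i s = 0) -> (2 * size s <= n)%N ->
  oddp s = 0.
Proof.
move=> two us s0 h ns.
have W0 : (oddp s)^`() * evenp s - (evenp s)^`() * oddp s = 0.
  apply: (small_dvdXn (evenp_oddp_wronskian h)).
  have [->|s1] := eqVneq s [::].
    rewrite /oddp /evenp /revprod big_nil rmorph1 subrr deriv0 mul0r mulr0 subr0.
    by rewrite size_poly0.
  have {s1} : (0 < size s)%N by case: (s) s1.
  have hU := size_evenp s; have hV := size_oddp s.
  have ld Q : (size Q <= (size s).+1)%N -> (size (Q^`()) <= size s)%N.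
    by move=> hQ; apply: leq_trans (size_poly _ _) _; lia.
  have hU' := ld _ hU; have hV' := ld _ hV.
  move=> s1; apply: leq_trans (size_polyD _ _) _; rewrite poly.size_polyN geq_max.
  have E : ((size s + (size s).+1).-1 <= n)%N by lia.
  by apply/andP; split; (apply: leq_trans E; apply: size_polyM_le).
apply: oddp_eq0_roots => // a ains.
have a0 : a != 0 by apply: contraNneq s0 => <-.
set y := a^-1.
have Py : (revprod s).[y] = 0 by apply/eqP; have := root_revprod s a0; rewrite /root ains.
have UVy : (evenp s).[y] + (oddp s).[y] = 0.
  by rewrite -hornerD even_oddp hornerMn Py mul0rn.
have : (evenp s).[y] * (evenp s + oddp s)^`().[y] = 0.
  move: (evenp s) (oddp s) UVy W0 => U V UVy /(congr1 (fun Q => Q.[y])).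
  rewrite derivD !hornerD hornerN !hornerM horner0.
  move/eqP: UVy; rewrite addrC addr_eq0 => /eqP -> H; rewrite -[RHS]H; ring.
rewrite even_oddp derivMn hornerMn => /eqP; rewrite mulf_eq0 => /orP[/eqP //|].
rewrite -mulr_natr mulf_eq0 (negPf two) orbF => /eqP.
have -> : revprod s = (1 - a *: 'X) * revprod (rem a s).
  by rewrite /revprod (big_rem a ains).
rewrite derivM derivB derivC derivZ derivX !hornerE mulfV // subrr mul0r addr0.
move=> /eqP; rewrite mulNr oppr_eq0 mulf_eq0 (negPf a0) /=.
have := root_revprod (rem a s) a0; rewrite /root => ->.
by rewrite mem_rem_uniq // inE eqxx.
Qed.

Lemma oddp_eq0_mem s a : oddp s = 0 -> a != 0 -> a \in s -> - a \in s.
Proof.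
move=> /eqP; rewrite subr_eq0 => /eqP E a0 ains.
have na0 : - a != 0 by rewrite oppr_eq0.
by rewrite -root_revprod // E /root /polyN horner_comp !hornerE invrN opprK
  -/(root _ _) root_revprod.
Qed.

End PolyParity.

(** * Quotients of power series modulo X^d *)

Section SeriesQuotient.
Variable K : fieldType.
Implicit Types (P Q U V w : {poly K}) (d : nat).

(** The geometric series of 1/U around U(0), cut off where the powers of 1 - U/U(0) become divisible
    by X^d. *)
Definition inv_series U d : {poly K} :=
  (U.[0])^-1 *: \sum_(i < d) (1 - (U.[0])^-1 *: U) ^+ i.

(** The reduced representative of V/U turns congruences modulo X^d into equalities; by uniqueness it
    then commutes with field morphisms and with X -> -X. *)
Definition quot_series U V d : {poly K} := (V * inv_series U d) %% 'X^d.

Lemma inv_seriesP U d : U.[0] != 0 -> 'X^d %| U * inv_series U d - 1.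
Proof.
move=> U0; rewrite /inv_series -scalerAr scalerAl.
set Z := 1 - _; have -> : (U.[0])^-1 *: U = 1 - Z by rewrite /Z opprB addrC subrK.
have -> : (1 - Z) * (\sum_(i < d) Z ^+ i) - 1 = - Z ^+ d.
  by rewrite -[1 - Z]opprB mulNr -subrX1 opprB addrAC subrr sub0r.
rewrite dvdpNr.
apply: dvdp_exp2r; rewrite -['X]subr0 -polyC0 dvdp_XsubCl /root /Z.
by rewrite hornerD hornerN hornerZ hornerC mulVf // subrr.
Qed.

Lemma coprimep_Xn U d : U.[0] != 0 -> coprimep 'X^d U.
Proof.
move=> U0; rewrite coprimep_sym; apply: coprimep_expr.
by have := coprimep_XsubC U 0; rewrite polyC0 subr0 => ->.
Qed.

Lemma size_quot_series U V d : (size (quot_series U V d) <= d)%N.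
Proof. by have := ltn_modp (V * inv_series U d) 'X^d; rewrite size_polyXn ltnS monic_neq0 ?monicXn. Qed.

Lemma quot_seriesP U V d : U.[0] != 0 -> 'X^d %| U * quot_series U V d - V.
Proof.
move=> U0; have E := divp_eq (V * inv_series U d) 'X^d.
have -> : quot_series U V d = V * inv_series U d - (V * inv_series U d) %/ 'X^d * 'X^d.
  by rewrite [X in X - _]E addrAC subrr add0r.
have -> : U * (V * inv_series U d - (V * inv_series U d) %/ 'X^d * 'X^d) - V
   = V * (U * inv_series U d - 1) - U * ((V * inv_series U d) %/ 'X^d) * 'X^d by ring.
by apply: dvdp_sub; [apply: dvdp_mull; apply: inv_seriesP|apply: dvdp_mull].
Qed.

Lemma quot_series_uniq U V d w : U.[0] != 0 -> (size w <= d)%N ->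
  'X^d %| U * w - V -> w = quot_series U V d.
Proof.
move=> U0 sw dw; apply/eqP; rewrite -subr_eq0; apply/eqP.
apply: (@small_dvdXn _ d).
  rewrite -(Gauss_dvdpr _ (coprimep_Xn d U0)).
  have -> : U * (w - quot_series U V d) = (U * w - V) - (U * quot_series U V d - V) by ring.
  by apply: dvdp_sub => //; apply: quot_seriesP.
by apply: leq_trans (size_polyD _ _) _; rewrite poly.size_polyN geq_max sw size_quot_series.
Qed.

(** Differentiating U w = V modulo X^(m+1) costs one order and gives U^2 w' = V' U - U' V modulo
    X^m; since w' has size at most m, it vanishes exactly. *)
Lemma deriv_quot_series U V m : U.[0] != 0 -> 'X^m %| V^`() * U - U^`() * V ->
  (quot_series U V m.+1)^`() = 0.
Proof.
move=> U0 dW; set w := quot_series U V m.+1.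
have /dvdpP[G EG] := quot_seriesP V m.+1 U0.
have dX : 'X^m %| U^`() * w + U * w^`() - V^`().
  move: EG => /(congr1 (fun Q => Q^`())); rewrite derivB !derivM -/w => ->.
  rewrite derivXn /= exprS.
  have -> : G^`() * ('X * 'X^m) + G * ('X^m *+ m.+1) = 'X^m * (G^`() * 'X + G *+ m.+1).
    by rewrite -mulr_natr -[G *+ _]mulr_natr; ring.
  exact: dvdp_mulr.
apply: (@small_dvdXn _ m).
  rewrite -(Gauss_dvdpr _ (coprimep_Xn m U0)) -(Gauss_dvdpr _ (coprimep_Xn m U0)).
  have -> : U * (U * w^`()) = U * (U^`() * w + U * w^`() - V^`())
     + (V^`() * U - U^`() * V) - U^`() * (U * w - V) by ring.
  apply: dvdp_sub; last by apply: dvdp_mull; rewrite EG exprS mulrA; apply: dvdp_mull.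
  by apply: dvdp_add => //; apply: dvdp_mull.
have := size_quot_series U V m.+1; rewrite -/w => hw.
have [->|w0] := eqVneq w 0; first by rewrite deriv0 size_poly0.
by have := leq_trans (lt_size_deriv w0) hw; rewrite ltnS.
Qed.

End SeriesQuotient.

(** * Transport along field morphisms; counting by fibres and by roots *)

Lemma map_polyN (K L : fieldType) (f : {rmorphism K -> L}) (P : {poly K}) :
  map_poly f (polyN P) = polyN (map_poly f P).
Proof. by rewrite /polyN map_comp_poly rmorphN /= map_polyX. Qed.

Lemma map_revprod (K L : fieldType) (f : {rmorphism K -> L}) (s : seq K) :
  map_poly f (revprod s) = revprod (map f s).
Proof.
rewrite /revprod rmorph_prod big_map; apply: eq_bigr => a _.
by rewrite rmorphB rmorph1 /= map_polyZ map_polyX.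
Qed.

Lemma map_evenp (K L : fieldType) (f : {rmorphism K -> L}) (s : seq K) :
  map_poly f (evenp s) = evenp (map f s).
Proof. by rewrite /evenp rmorphD /= map_polyN map_revprod. Qed.

Lemma map_oddp (K L : fieldType) (f : {rmorphism K -> L}) (s : seq K) :
  map_poly f (oddp s) = oddp (map f s).
Proof. by rewrite /oddp rmorphB /= map_polyN map_revprod. Qed.

Lemma perm_revprod (K : fieldType) (s t : seq K) : perm_eq s t -> revprod s = revprod t.
Proof. by move=> st; apply: perm_big. Qed.

Lemma map_quot_series (K L : fieldType) (f : {rmorphism K -> L}) (U V : {poly K}) d :
  U.[0] != 0 ->
  map_poly f (quot_series U V d) = quot_series (map_poly f U) (map_poly f V) d.
Proof.
move=> U0; apply: quot_series_uniq.
- have -> : (map_poly f U).[0] = f U.[0] by rewrite -horner_map rmorph0.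
  by rewrite fmorph_eq0.
- by rewrite size_map_poly size_quot_series.
- by rewrite -(map_polyXn f) -rmorphM -rmorphB dvdp_map quot_seriesP.
Qed.

Lemma leq_card_fibers (T S : finType) (A : {set T}) (B : {pred S}) (f : T -> S) m :
  (forall a, a \in A -> f a \in B) ->
  (forall b, (#|[set a in A | f a == b]| <= m)%N) -> (#|A| <= #|B| * m)%N.
Proof.
move=> fAB hm; rewrite -sum1_card (partition_big f (mem B)) //=.
rewrite -sum_nat_const; apply: leq_sum => b _.
by rewrite sum1_card -cardsE; apply: leq_trans (hm b); apply: subset_leq_card;
   apply/subsetP => x; rewrite !inE.
Qed.

Lemma leq_card_roots (K : finFieldType) (P : {poly K}) (A : {set K}) m :
  P != 0 -> (size P <= m.+1)%N -> (forall a, a \in A -> root P a) -> (#|A| <= m)%N.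
Proof.
move=> P0 sP h; have := @max_poly_roots _ P (enum A) P0.
rewrite -cardE enum_uniq => /(_ _ isT) H; rewrite -ltnS; apply: leq_trans sP.
by apply: H; apply/allP => x; rewrite mem_enum => /h.
Qed.

Lemma leq_expn2r a b k : (a <= b -> a ^ k <= b ^ k)%N.
Proof. by case: k => [|k] ab; rewrite ?expn0 // leq_exp2r. Qed.

Lemma card_odd_ge m d : (#|[pred i : 'I_(2 * m) | odd i && (d <= i)]| <= m - d./2)%N.
Proof.
rewrite -sum1_card (eq_bigl (fun i : 'I_(2 * m) => odd i && (d <= i)%N)) //.
rewrite big_mkcond -(big_mkord xpredT (fun i => if odd i && (d <= i)%N then 1%N else 0%N)).
elim: m => [|m IH]; first by rewrite muln0 big_geq.
rewrite mulnS add2n big_nat_recr //= big_nat_recr //=.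
rewrite mul2n odd_double /= -mul2n addn0.
by case: ifP => h; move: IH; set S := \big[_/_]_(_ <= _ < _) _; rewrite /= => IH; lia.
Qed.

(** * Frobenius orbits and the count of long orbits *)

Section Frobenius.
Variables (E : finFieldType) (p n : nat).
Hypotheses (pE : p \in [pchar E]) (p_gt2 : (2 < p)%N) (n_gt0 : (0 < n)%N).
Implicit Types (x y : E).

Definition frob x : E := x ^+ (p ^ n).

Lemma pnat_expp k : [pchar E].-nat (p ^ k)%N.
Proof.
rewrite pnatX; apply/orP; left; have pr := pcharf_prime pE.
by rewrite (eq_pnat _ (pcharf_eq pE)) pnat_id.
Qed.

Lemma frob_is_nmod_morphism : nmod_morphism frob.
Proof.
split=> [|x y]; rewrite /frob ?exprDn_pchar ?pnat_expp //.
by rewrite expr0n expn_eq0 eqn0Ngt (prime_gt0 (pcharf_prime pE)).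
Qed.

Lemma frob_is_monoid_morphism : monoid_morphism frob.
Proof. by split=> [|x y]; rewrite /frob ?expr1n ?exprMn. Qed.

HB.instance Definition _ := GRing.isNmodMorphism.Build _ _ frob frob_is_nmod_morphism.
HB.instance Definition _ := GRing.isMonoidMorphism.Build _ _ frob frob_is_monoid_morphism.

Lemma frob_inj : injective frob.
Proof. exact: fmorph_inj. Qed.

Lemma frob_horner (Q : {poly E}) x :
  (forall i, frob Q`_i = Q`_i) -> frob Q.[x] = Q.[frob x].
Proof.
move=> h; rewrite -horner_map; congr (_.[_]).
by apply/polyP => i; rewrite coef_map [LHS]h.
Qed.

Lemma iter_frob k x : iter k frob x = x ^+ ((p ^ n) ^ k).
Proof. by elim: k => [|k IH] //=; rewrite IH /frob -exprM expnSr. Qed.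

Lemma iter_frobN k x : iter k frob (- x) = - iter k frob x.
Proof. by elim: k => [|k IH] //=; rewrite IH rmorphN. Qed.

Lemma two_neq0 : (2 : E) != 0.
Proof.
apply/negP => /eqP two0; have : 2 \in [pchar E] by rewrite inE /= two0 eqxx.
by rewrite (pcharf_eq pE) inE => /eqP e; move: p_gt2; rewrite -e.
Qed.

Lemma coef_odd_poly (Q : {poly E}) i : polyN Q = - Q -> ~~ odd i -> Q`_i = 0.
Proof.
move=> e ei; have := coef_polyN Q i; rewrite -signr_odd (negPf ei) mul1r e coefN.
move=> h; have : Q`_i *+ 2 = 0 by rewrite mulr2n -{1}h addNr.
by rewrite -mulr_natr => /eqP; rewrite mulf_eq0 (negPf two_neq0) orbF => /eqP.
Qed.

Lemma opp_neq x : x != 0 -> - x != x.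
Proof.
move=> x0; rewrite -subr_eq0 -opprD oppr_eq0 -mulr2n -mulr_natr mulf_eq0.
by rewrite (negPf x0) (negPf two_neq0).
Qed.

Lemma iter_frob_fix k x : iter k frob x = x -> (order frob x %| k)%N.
Proof.
move=> h; set o := order frob x.
have iM m : iter (m * o) frob x = x.
  by elim: m => [|m IH] //; rewrite mulSn iterD IH iter_order //; exact: frob_inj.
have : iter (k %% o) frob x = x by rewrite -{2}h {2}(divn_eq k o) addnC iterD iM.
move=> e; have := @findex_iter _ frob x (k %% o); rewrite e findex0 /dvdn => <- //.
by rewrite ltn_mod order_gt0.
Qed.

Lemma perm_frob_orbit x : perm_eq (map frob (orbit frob x)) (orbit frob x).
Proof.
apply: uniq_perm; rewrite ?orbit_uniq ?(map_inj_uniq frob_inj) ?orbit_uniq //.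
apply: (uniq_min_size _ _ _).2; rewrite ?size_map ?(map_inj_uniq frob_inj) ?orbit_uniq //.
by move=> _ /mapP[y yo ->]; apply: mem_orbit.
Qed.

Let P x := revprod (orbit frob x).
Let U x := evenp (orbit frob x).
Let V x := oddp (orbit frob x).

Lemma frob_evenp x : map_poly frob (U x) = U x.
Proof. by rewrite /U map_evenp /evenp (perm_revprod (perm_frob_orbit x)). Qed.

Lemma frob_oddp x : map_poly frob (V x) = V x.
Proof. by rewrite /V map_oddp /oddp (perm_revprod (perm_frob_orbit x)). Qed.

Lemma orbit_neq0 x : x != 0 -> 0 \notin orbit frob x.
Proof.
move=> x0; rewrite -fconnect_orbit fconnect_sym; last exact: frob_inj.
rewrite fconnect_orbit; apply: contra x0 => /trajectP[i _ ->].
by elim: i => [|i IH] //=; rewrite fmorph_eq0.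
Qed.

(** U has coefficients fixed by Frobenius, so a zero at one y^-1 spreads to the inverses of the
    whole orbit, and [oddp_eq0_roots] would give V = 0. *)
Lemma evenp_neq0 x y : x != 0 -> V x != 0 -> y \in orbit frob x -> (U x).[y^-1] != 0.
Proof.
move=> x0 V0 yo; apply: contra V0 => /eqP Uy; apply/eqP.
apply: oddp_eq0_roots => [||b bo]; first exact: orbit_uniq.
  exact: orbit_neq0.
have : fconnect frob y b.
  rewrite -!fconnect_orbit in yo bo; apply: connect_trans bo.
  by rewrite fconnect_sym //; exact: frob_inj.
rewrite fconnect_orbit => /trajectP[j _ ->]; rewrite -/(U x).
elim: j => [|j IH] //=.
by rewrite -fmorphV -{1}frob_evenp horner_map IH rmorph0.
Qed.

Lemma psum_mulp i (s : seq E) : psum (i * p) s = psum i s ^+ p.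
Proof.
rewrite /psum -[RHS](pFrobenius_autE pE) rmorph_sum; apply: eq_bigr => a _.
by rewrite /= pFrobenius_autE exprM.
Qed.

(** The family has no coefficients at multiples of p, but in characteristic p the power sum of
    exponent jp is the p-th power of that of exponent j: vanishing descends from i to i/p, which is
    again odd. *)
Lemma psum_odd_eq0 d (s : seq E) :
  (forall i, (i < d)%N -> odd i -> ~~ (p %| i)%N -> psum i s = 0) ->
  forall i, (i < d)%N -> odd i -> psum i s = 0.
Proof.
move=> h i; have [m] := ubnP i; elim: m i => // m IH i im id oi.
have [/dvdnP[j ej]|] := boolP (p %| i)%N; last exact: h.
have p0 := prime_gt0 (pcharf_prime pE).
have oj : odd j by move: oi; rewrite ej oddM => /andP[].
have ji : (j < i)%N by rewrite ej; nia.
rewrite ej psum_mulp IH //; [by rewrite expr0n eqn0Ngt p0|lia|lia].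
Qed.

Variable r : nat.

(** The trace of [x ^+ i] from the field with q^r elements to F_q, written as a power sum of the r
    conjugates of x counted with repetition, so that Newton's identities apply. *)
Definition trace_pow i x := psum i (traject frob x r).

Definition odd_traces0 d x :=
  [forall i : 'I_d, (odd i && ~~ (p %| i)%N) ==> (trace_pow i x == 0)].

Lemma odd_traces0P d x : odd_traces0 d x ->
  forall i, (i < d)%N -> odd i -> trace_pow i x = 0.
Proof.
move=> /forallP h; apply: psum_odd_eq0 => i id oi pi.
by have := h (Ordinal id); rewrite /= oi pi => /eqP.
Qed.

(* [V x = 0] means that the orbit of x is stable under negation. *)
Definition long_orbit_set d := [set x : E | [&& x != 0, order frob x == r,
   odd_traces0 d x & V x != 0]].

Lemma card_frob_fixed : (#|[pred x : E | frob x == x]| <= p ^ n)%N.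
Proof.
rewrite -cardsE; have q1 : (1 < p ^ n)%N by rewrite -(exp1n n) ltn_exp2r //; lia.
have sX : size ('X^(p ^ n) - 'X : {poly E}) = (p ^ n).+1.
  by rewrite size_polyDl size_polyXn // poly.size_polyN size_polyX.
apply: (@leq_card_roots _ ('X^(p ^ n) - 'X)); rewrite ?sX // -?size_poly_gt0 ?sX //.
by move=> x; rewrite !inE /root !hornerE subr_eq0.
Qed.

Let W d x := quot_series (U x) (V x) d.

Lemma evenp_at0_neq0 x : (U x).[0] != 0.
Proof. by rewrite /U evenp0 two_neq0. Qed.

Lemma frob_W d x : map_poly frob (W d x) = W d x.
Proof. by rewrite /W map_quot_series ?evenp_at0_neq0 // frob_evenp frob_oddp. Qed.

(** As U is even and V odd, -W(-X) solves the same congruence as W, and uniqueness identifies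
    them. *)
Lemma coef_W_even d x i : ~~ odd i -> (W d x)`_i = 0.
Proof.
move=> ei; apply: coef_odd_poly => //; rewrite -[LHS]opprK; congr (- _).
apply: quot_series_uniq; first exact: evenp_at0_neq0.
  by rewrite poly.size_polyN; apply: leq_trans (size_polyN _) (size_quot_series _ _ _).
have := dvdp_XnN (quot_seriesP (V x) d (evenp_at0_neq0 x)).
rewrite rmorphB rmorphM /= [polyN (U x)]polyN_evenp [polyN (V x)]polyN_oddp -/(U x) -/(V x).
by rewrite mulrN -opprD dvdpNr opprK.
Qed.

Lemma long_orbit_psum d x : x \in long_orbit_set d ->
  forall i, (i < d)%N -> odd i -> psum i (orbit frob x) = 0.
Proof.
by rewrite inE => /and4P[_ /eqP o t _]; rewrite /orbit o; exact: odd_traces0P.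
Qed.

Lemma coef_W_p d x i : x \in long_orbit_set d -> ~~ (p %| i)%N -> (W d x)`_i = 0.
Proof.
case: d => [|m] fx pi.
  by apply: nth_default; apply: leq_trans (size_quot_series _ _ _) _.
have h : (W m.+1 x)^`() = 0.
  apply: deriv_quot_series (evenp_at0_neq0 x) _; apply: evenp_oddp_wronskian => j jm oj.
  exact: (long_orbit_psum fx).
case: i pi => [|i pi]; first by rewrite dvdn0.
move: h => /(congr1 (fun Q : {poly E} => Q`_i)); rewrite coef_deriv coef0.
move=> /eqP; rewrite -mulr_natr mulf_eq0 => /orP[/eqP //|].
by rewrite -(dvdn_pcharf pE) (negPf pi).
Qed.

Lemma dvd_cross d x y : W d x = W d y -> 'X^d %| U x * V y - U y * V x.
Proof.
move=> e; have hx := quot_seriesP (V x) d (evenp_at0_neq0 x); have hy := quot_seriesP (V y) d (evenp_at0_neq0 y).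
rewrite -/(W d x) in hx; rewrite -/(W d y) -e in hy.
have -> : U x * V y - U y * V x = U y * (U x * W d x - V x) - U x * (U y * W d x - V y).
  by ring.
by apply: dvdp_sub; apply: dvdp_mull.
Qed.

(** At a^-1, for a in the orbit of x, V_x = -U_x, so U_x V_y - U_y V_x takes the value 2 U_x P_y,
    with U_x nonzero by [evenp_neq0]. Hence P_y - P_z vanishes at these r points and at 0, while its
    degree is at most r. *)
Lemma cross_inj d x y z : x \in long_orbit_set d -> y \in long_orbit_set d -> z \in long_orbit_set d ->
  U x * V y - U y * V x = U x * V z - U z * V x -> P y = P z.
Proof.
rewrite !inE => /and4P[x0 /eqP ox _ Vx] /and4P[_ /eqP oy _ _] /and4P[_ /eqP oz _ _] e.
apply/eqP; rewrite -subr_eq0; apply/negPn/negP => D0.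
have sP u : (size (P u) <= (order frob u).+1)%N by rewrite -size_orbit; exact: size_revprod.
have := @max_poly_roots _ _ (0 :: [seq a^-1 | a <- orbit frob x]) D0.
have inj : injective (@GRing.inv E) by exact: invr_inj.
rewrite /= size_map size_orbit ox (map_inj_uniq inj) orbit_uniq andbT.
have -> : 0 \notin [seq a^-1 | a <- orbit frob x].
  apply/mapP => -[a ains /eqP]; rewrite eq_sym invr_eq0 => /eqP a0.
  by have := orbit_neq0 x0; rewrite -a0 ains.
move=> /(_ _ isT) H.
have : ((size (P y - P z)%R <= r.+1)%N).
  apply: leq_trans (size_polyD _ _) _; rewrite poly.size_polyN geq_max.
  by rewrite -{1}oy -oz !sP.
rewrite leqNgt H //; apply/andP; split.
  by rewrite /root hornerD hornerN /P !revprod0 subrr.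
apply/allP => _ /mapP[a ains ->].
have a0 : a != 0 by apply: contraNneq (orbit_neq0 x0) => <-.
have Px : (P x).[a^-1] = 0 by apply/rootP; rewrite /P root_revprod.
have UVx : (V x).[a^-1] = - (U x).[a^-1].
  by apply/eqP; rewrite -addr_eq0 addrC -hornerD even_oddp hornerMn Px mul0rn.
have Ua := evenp_neq0 x0 Vx ains.
have: (U x).[a^-1] * ((U y + V y - (U z + V z)).[a^-1]) = 0.
  move: e => /(congr1 (fun Q => Q.[a^-1])).
  move: (U x) (V x) (U y) (V y) (U z) (V z) UVx => Ux Wx Uy Wy Uz Wz UVx.
  rewrite !hornerD !hornerN !hornerM UVx !hornerD => /eqP.
  by rewrite -subr_eq0 => /eqP h; rewrite -[RHS]h; ring.
rewrite !even_oddp -mulrnBl hornerMn -mulr_natr => /eqP.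
by rewrite !mulf_eq0 (negPf Ua) (negPf two_neq0) orbF.
Qed.

(** The exponent e: the number of free coefficients of an odd series in X^p modulo X^d. *)
Definition odd_mult d := #|[pred i : 'I_d | odd i && (p %| i)%N]|.

Lemma size_cross d x y : x \in long_orbit_set d -> y \in long_orbit_set d ->
  (size (U x * V y - U y * V x)%R <= (2 * r).+1)%N.
Proof.
rewrite !inE => /and4P[_ /eqP ox _ _] /and4P[_ /eqP oy _ _].
have sU u : (size (U u) <= (order frob u).+1)%N by rewrite -size_orbit; exact: size_evenp.
have sV u : (size (V u) <= (order frob u).+1)%N by rewrite -size_orbit; exact: size_oddp.
have e : ((r.+1 + r.+1).-1 <= (2 * r).+1)%N by lia.
apply: leq_trans (size_polyD _ _) _; rewrite poly.size_polyN geq_max.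
by apply/andP; split; (apply: leq_trans e; apply: size_polyM_le); rewrite ?(leq_trans (sU _)) ?(leq_trans (sV _)) ?ox ?oy.
Qed.

(* By the Wronskian identity the series V/U mod X^d has zero derivative, so it
   is an odd series in X^p over F_q, which leaves q^(odd_mult d) possibilities.
   Once V_x/U_x = V_y/U_y mod X^d, the odd polynomial U_x V_y - U_y V_x over F_q
   has degree at most 2r and is divisible by X^d, and it determines the orbit of y. *)
Lemma card_long_orbit_set d : (#|long_orbit_set d| <= (p ^ n) ^ odd_mult d * ((p ^ n) ^ (r - d./2) * r))%N.
Proof.
set K := [pred x : E | frob x == x].
have cK : (#|K| <= p ^ n)%N by exact: card_frob_fixed.
pose f1 x := [ffun i : 'I_d => (W d x)`_i].
pose D1 := [pred i : 'I_d | odd i && (p %| i)%N].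
have := @leq_card_fibers _ _ (long_orbit_set d) (pffun_on 0 D1 K) f1
   ((p ^ n) ^ (r - d./2) * r).
move=> H; apply: leq_trans (H _ _) _; last 1 first.
- by rewrite leq_mul2r card_pffun_on leq_expn2r ?orbT.
- move=> x fx; apply/pffun_onP; split.
    apply/subsetP => i; rewrite inE /f1 ffunE => wi.
    rewrite !inE; apply/andP; split; apply: contraNT wi => h; apply/eqP.
      exact: coef_W_even.
    exact: coef_W_p.
  move=> _ /imageP[i _ ->]; rewrite inE /f1 ffunE; apply/eqP.
  by rewrite -{2}(frob_W d x) coef_map.
move=> b; set A1 := [set x in long_orbit_set d | f1 x == b].
have [->|[x xA]] := set_0Vmem A1; first by rewrite cards0.
pose C y := U x * V y - U y * V x.
pose f2 y := [ffun i : 'I_(2 * r) => (C y)`_i].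
pose D2 := [pred i : 'I_(2 * r) | odd i && (d <= i)%N].
have fx : x \in long_orbit_set d by move: xA; rewrite inE => /andP[].
have fA y : y \in A1 -> y \in long_orbit_set d by rewrite inE => /andP[].
have WE y : y \in A1 -> W d x = W d y.
  move: xA; rewrite !inE => /andP[_ /eqP <-] /andP[_ /eqP e].
  apply/polyP => i; have [id|di] := ltnP i d.
    by move/ffunP: e => /(_ (Ordinal id)); rewrite !ffunE.
  by rewrite !nth_default //; apply: leq_trans (size_quot_series _ _ _) _.
have Codd y i : ~~ odd i -> (C y)`_i = 0.
  apply: coef_odd_poly; rewrite /C rmorphB !rmorphM /=.
  rewrite ![polyN (U _)]polyN_evenp ![polyN (V _)]polyN_oddp -/(U x) -/(V x) -/(U y) -/(V y).
  by rewrite !mulrN -opprD.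
have := @leq_card_fibers _ _ A1 (pffun_on 0 D2 K) f2 r.
move=> H2; apply: leq_trans (H2 _ _) _; last 1 first.
- rewrite leq_mul2r card_pffun_on; apply/orP; right.
  apply: leq_trans (_ : (p ^ n) ^ #|D2| <= _)%N; first exact: leq_expn2r.
  apply: leq_pexp2l; last exact: card_odd_ge.
  by rewrite expn_gt0 (prime_gt0 (pcharf_prime pE)).
- move=> y yA; apply/pffun_onP; split.
    apply/subsetP => i; rewrite inE /f2 ffunE => ci.
    rewrite !inE; apply/andP; split; apply: contraNT ci => h; apply/eqP; first exact: Codd.
    have /dvdpP[Q eQ] : 'X^d %| C y by apply: dvd_cross; exact: WE.
    by rewrite eQ coefMXn ltnNge h.
  move=> _ /imageP[i _ ->]; rewrite inE /f2 ffunE -coef_map.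
  by rewrite /C rmorphB !rmorphM /= !frob_evenp !frob_oddp.
move=> b2; set A2 := [set y in A1 | f2 y == b2].
have [->|[y yA]] := set_0Vmem A2; first by rewrite cards0.
have oy : order frob y = r.
  by move: yA; rewrite !inE => /andP[/andP[/and4P[_ /eqP ->]]].
rewrite -oy -size_orbit -(card_uniqP (orbit_uniq _ _)).
apply: subset_leq_card; apply/subsetP => z zA.
have yA1 : y \in A1 by move: yA; rewrite inE => /andP[].
have zA1 : z \in A1 by move: zA; rewrite inE => /andP[].
have z0 : z != 0 by have := fA z zA1; rewrite inE => /andP[].
rewrite -root_revprod //.
have CE : C y = C z.
  move: yA zA; rewrite !inE => /andP[_ /eqP <-] /andP[_ /eqP e].
  apply/polyP => i; have [ir|ri] := ltnP i (2 * r).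
    by move/ffunP: e => /(_ (Ordinal ir)); rewrite !ffunE.
  have [oi|ei] := boolP (odd i); last by rewrite !Codd.
  (* Degree 2r is allowed by [size_cross] but not recorded by [f2]; an odd i that is at least 2r
     exceeds 2r, so both coefficients are 0. *)
  rewrite !nth_default //; (apply: leq_trans (size_cross fx (fA _ _)) _; first by []);
  by rewrite ltn_neqAle ri andbT; apply: contraTneq oi => <-; rewrite mul2n odd_double.
have -> : revprod (orbit frob y) = revprod (orbit frob z).
  exact: (cross_inj fx (fA _ yA1) (fA _ zA1) CE).
by rewrite root_revprod // in_orbit.
Qed.

End Frobenius.

(** * Elements whose odd traces all vanish *)

Section BadSet.
Variables (E : finFieldType) (p n r : nat).
Hypotheses (pE : p \in [pchar E]) (p_gt2 : (2 < p)%N) (n_gt0 : (0 < n)%N).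
Hypotheses (r_gt0 : (0 < r)%N) (cE : #|E| = ((p ^ n) ^ r)%N).
Implicit Types (x y : E).

Local Notation frob := (@frob E p n).
Local Notation q := (p ^ n)%N.

(* Every odd f takes values of trace zero at such x: they give the main term q^(r/2). *)
Definition half_conj x := ~~ odd r && (iter r./2 frob x == - x).

Lemma frob_exp_gt1 : (1 < q)%N.
Proof. by rewrite -(exp1n n) ltn_exp2r //; lia. Qed.

Lemma card_root_Xq k (c b : E) : (0 < k)%N ->
  (#|[set x : E | (iter k frob x + c * x)%R == b]| <= q ^ k)%N.
Proof.
move=> k0; have qk : (1 < q ^ k)%N by rewrite -(exp1n k) ltn_exp2r // frob_exp_gt1.
have sc : (size (c *: 'X - b%:P : {poly E})%R < (q ^ k).+1)%N.
  apply: leq_ltn_trans (size_polyD _ _) _; rewrite poly.size_polyN gtn_max.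
  apply/andP; split; first by apply: leq_ltn_trans (size_scale_leq _ _) _; rewrite size_polyX.
  by apply: leq_ltn_trans (size_polyC_leq1 _) _; apply: ltnW.
have sX : size ('X^(q ^ k) + (c *: 'X - b%:P) : {poly E}) = (q ^ k).+1.
  by rewrite size_polyDl size_polyXn.
apply: (@leq_card_roots _ ('X^(q ^ k) + (c *: 'X - b%:P))); rewrite ?sX // -?size_poly_gt0 ?sX //.
by move=> x; rewrite !inE iter_frob /root !hornerD hornerN hornerZ hornerXn hornerX hornerC addrA subr_eq0.
Qed.

Lemma iter_frob_r x : iter r frob x = x.
Proof. by rewrite iter_frob -cE expf_card. Qed.

(** The upper bound is the degree of X^(q^m) + X, m = r/2. For the lower one, x -> x^(q^m) - x maps
    E into the set with fibres of at most q^m elements, and E has q^(2m) elements. *)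
Lemma card_half_conj : ~~ odd r -> #|[set x : E | half_conj x]| = (q ^ r./2)%N.
Proof.
move=> er; set m := r./2; have r2 : r = (m + m)%N by rewrite addnn -[RHS]addn0 -[in LHS](odd_double_half r) (negPf er) addn0.
have m0 : (0 < m)%N by move: r2 r_gt0; lia.
have hE : [set x : E | half_conj x] = [set x : E | iter m frob x + 1 * x == 0].
  by apply/setP => x; rewrite !inE /half_conj er /= mul1r addr_eq0.
apply/eqP; rewrite eqn_leq {1}hE card_root_Xq //=.
have := @leq_card_fibers _ _ [set: E] (mem [set x : E | half_conj x])
   (fun x => iter m frob x + (-1) * x) (q ^ m).
have q0 : (0 < q ^ m)%N by rewrite expn_gt0; apply/orP; left; exact: ltnW frob_exp_gt1.
move=> H; rewrite -(@leq_pmul2r (q ^ m)) //.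
rewrite -expnD -r2 -cE -cardsT; apply: H.
- move=> x _; rewrite !inE /half_conj er /= -/m mulN1r !iter_frob.
  by rewrite exprDn_pchar -?expnM ?pnat_expp // expnM -!iter_frob iter_frobN // -iterD -r2 iter_frob_r addrC opprD opprK.
- move=> b; apply: leq_trans (card_root_Xq (-1) b m0); apply: subset_leq_card.
  by apply/subsetP => x; rewrite !inE.
Qed.

(** By symmetry of the orbit, [- x] is [iter j frob x] for some 0 < j < k, k being the order of x;
    then k divides 2j < 2k, so k = 2j. *)
Lemma orbit_oppP x : x != 0 -> oddp (orbit frob x) = 0 ->
  ~~ odd (order frob x) /\ iter (order frob x)./2 frob x = - x.
Proof.
move=> x0 V0; have := oddp_eq0_mem V0 x0 (in_orbit _ _).
move=> /trajectP[j jk ej].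
have e2 : iter (j + j) frob x = x by rewrite iterD -ej iter_frobN // -ej opprK.
have := iter_frob_fix pE e2.
have j0 : (0 < j)%N.
  by case: j {jk e2} ej => // /eqP; rewrite /= (negPf (opp_neq pE p_gt2 x0)).
move=> /dvdnP[m em].
have k2 : order frob x = (j + j)%N by move: em jk j0; case: m => [|[|m]];
  rewrite ?mul0n ?mul1n // => em jk j0; [lia|move: em; set k := order _ _; nia].
by rewrite k2 addnn odd_double doubleK.
Qed.

Variable d : nat.
Hypotheses (d_odd : odd d) (r_lt_d : (r < d)%N).

(** The elements that averaging does not kill and that lie outside the main term; they enter the
    error through their number alone. *)
Definition bad_set := [set x : E | odd_traces0 p n r d x && ~~ half_conj x].

(** The trace runs m times over the orbit. A general m could be divisible by p and hide the power
    sums of the orbit; m = 1 and m = 2 are invertible because p is odd. *)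
Lemma psum_orbit_eq0 m x : (m * order frob x)%N = r -> (m == 1%N) || (m == 2%N) ->
  odd_traces0 p n r d x ->
  forall i, (i < d)%N -> odd i -> psum i (orbit frob x) = 0.
Proof.
move=> mr m12 t i id oi; have := odd_traces0P pE p_gt2 n_gt0 t id oi.
rewrite /trace_pow -mr; case/orP: m12 => /eqP ->; first by rewrite mul1n.
rewrite mul2n -addnn trajectD iter_order; last exact: frob_inj.
rewrite /psum big_cat /= -mulr2n -mulr_natr => /eqP.
by rewrite mulf_eq0 (negPf (two_neq0 pE p_gt2)) orbF => /eqP.
Qed.

(** Let k be the order of x and r = m k. If m is at least 3, x lies in a field with q^k elements, k
    at most r/3. If m = 2, then 2k = r < d forces V = 0, so x^(q^(r/4)) = -x. If m = 1, then V is
    nonzero because x is not in the main term; this is a long orbit, impossible when 2r < d. *)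
Lemma card_bad_set : (#|bad_set| <= 1 + \sum_(1 <= k < (r %/ 3).+1) q ^ k + q ^ (r %/ 4)
   + (if (2 * r < d)%N then 0 else q ^ odd_mult p d * (q ^ (r - d./2) * r)))%N.
Proof.
pose A0 := [set 0 : E].
pose A1 := \bigcup_(k < (r %/ 3).+1 | (0 < k)%N) [set x : E | iter k frob x + (-1) * x == 0].
pose A2 := if (0 < r %/ 4)%N then [set x : E | iter (r %/ 4) frob x + 1 * x == 0] else set0.
pose A3 := if (2 * r < d)%N then set0 else @long_orbit_set E p n r d.
have sub : bad_set \subset A0 :|: A1 :|: A2 :|: A3.
  apply/subsetP => x; rewrite inE => /andP[t nh].
  have [->|x0] := eqVneq x 0; first by rewrite !inE eqxx.
  have /dvdnP[m em] := iter_frob_fix pE (iter_frob_r x).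
  have k0 : (0 < order frob x)%N by exact: order_gt0.
  set k := order frob x in em k0.
  have kx : iter k frob x = x by rewrite iter_order //; exact: frob_inj.
  have ou := orbit_uniq frob x.
  have o0 : 0 \notin orbit frob x by exact: orbit_neq0.
  have small : (m == 1%N) || (m == 2%N) -> (2 * k < d)%N -> oddp (orbit frob x) = 0.
    move=> m12 kd; apply: (@oddp_eq0_small _ _ d.-1) => //; first exact: two_neq0 pE p_gt2.
      move=> i id; apply: (psum_orbit_eq0 (esym em)) => //; lia.
    by rewrite size_orbit -/k; lia.
  have [m3|m3] := leqP 3 m.
    suff xA1 : x \in A1 by rewrite !in_setU xA1 orbT.
    have kr : (k < (r %/ 3).+1)%N by rewrite ltnS leq_divRL // em mulnC leq_mul2r m3 orbT.
    apply/bigcupP; exists (Ordinal kr) => //.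
    by rewrite inE /= kx mulN1r subrr.
  have [m2|m2] := eqVneq m 2%N.
    have kd : (2 * k < d)%N by rewrite -m2 -em.
    have [e2 h2] := orbit_oppP x0 (small (introT orP (or_intror (introT eqP m2))) kd).
    rewrite -/k in e2 h2.
    have r4 : (r %/ 4)%N = k./2 by rewrite em m2; move: e2; lia.
    have k20 : (0 < k./2)%N by move: e2 k0; lia.
    suff xA2 : x \in A2 by rewrite !in_setU xA2 orbT.
    by rewrite /A2 r4 k20 inE h2 mul1r addNr.
  have m1 : m = 1%N by move: em r_gt0 m3 m2; case: (m) => [|[|[|]]]; lia.
  have rk : r = k by rewrite em m1 mul1n.
  have V0 : oddp (orbit frob x) != 0.
    apply: contra nh => /eqP V0; have [e2 h2] := orbit_oppP x0 V0.
    by rewrite /half_conj rk e2 h2 eqxx.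
  have kd : (2 * r < d)%N = false.
    by apply: contraNF V0 => kd; apply/eqP; apply: small; rewrite ?m1 // -rk.
  suff xA3 : x \in A3 by rewrite !in_setU xA3 orbT.
  by rewrite /A3 kd inE x0 -/k -rk eqxx t.
apply: leq_trans (subset_leq_card sub) _.
apply: leq_trans (leq_card_setU _ _) _; apply: leq_add; last first.
  by rewrite /A3; case: ifP; rewrite ?cards0 // => _; exact: card_long_orbit_set.
apply: leq_trans (leq_card_setU _ _) _; apply: leq_add; last first.
  by rewrite /A2; case: ifP => h; rewrite ?cards0 // card_root_Xq.
apply: leq_trans (leq_card_setU _ _) _; apply: leq_add; first by rewrite cards1.
have -> : (\sum_(1 <= k < (r %/ 3).+1) q ^ k = \sum_(k < (r %/ 3).+1 | (0 < k)%N) q ^ k)%N.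
  rewrite -(big_mkord (fun k => 0 < k)%N (fun k => q ^ k)%N) [RHS]big_ltn_cond //=.
  by rewrite [RHS]big_nat_cond [LHS]big_nat_cond; apply: eq_bigl => k; case: (0 < k)%N; rewrite ?andbF ?andbT.
apply: (big_ind2 (fun (A : {set E}) (m : nat) => (#|A| <= m)%N)).
- by rewrite cards0.
- by move=> A a B b hA hB; apply: leq_trans (leq_card_setU _ _) (leq_add hA hB).
- by move=> k k0; exact: card_root_Xq.
Qed.

End BadSet.

(** * Additive characters composed with the absolute trace *)

Section TraceCharacter.
Variables (C : numFieldType) (p : nat) (psi : 'F_p -> C).
Hypotheses (p_prime : prime p).
Hypothesis psi_add : forall a b : 'F_p, psi (a + b) = psi a * psi b.
Hypothesis psi_neq0 : forall a : 'F_p, psi a != 0.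

Lemma psi0 : psi 0 = 1.
Proof.
by apply: (mulfI (psi_neq0 0)); rewrite -psi_add addr0 mulr1.
Qed.

Lemma norm_psi a : `|psi a| = 1.
Proof.
have psiM k : psi (a *+ k) = psi a ^+ k.
  by elim: k => [|k IH]; rewrite ?mulr0n ?psi0 // mulrS psi_add IH exprS.
have := psiM p; rewrite -mulr_natr pchar_Fp_0 // mulr0 psi0 => /esym /(congr1 Num.norm).
rewrite normrX normr1 => /eqP; rewrite pexpr_eq1 ?prime_gt0 ?normr_ge0 //.
by move/eqP.
Qed.

Variable E : finFieldType.
Hypothesis pE : p \in [pchar E].
Implicit Types (x y : E).

Lemma card_pchar : #|E| = (p ^ logn p #|E|)%N.
Proof. exact: card_pprimeChar pE. Qed.

Lemma trFpD x y : trFp p (x + y) = trFp p x + trFp p y.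
Proof.
rewrite /trFp -big_split; apply: eq_bigr => j _.
by rewrite exprDn_pchar // pnat_expp.
Qed.

Lemma trFp0 : trFp p (0 : E) = 0.
Proof. by apply: (addrI (trFp p (0 : E))); rewrite -trFpD !addr0. Qed.

Lemma trFpMn x k : trFp p (x *+ k) = trFp p x *+ k.
Proof. by elim: k => [|k IH]; rewrite ?mulr0n ?trFp0 // !mulrS trFpD IH. Qed.

Lemma trFp_fixed x : trFp p x ^+ p = trFp p x.
Proof.
rewrite -[LHS](pFrobenius_autE pE) /trFp rmorph_sum /=.
under eq_bigr do rewrite pFrobenius_autE -exprM -expnSr.
have : x ^+ (p ^ logn p #|E|) = x by rewrite -card_pchar expf_card.
case: (logn p #|E|) => [|m] xm; first by rewrite !big_ord0.
by rewrite big_ord_recr [RHS]big_ord_recl /= xm expn0 expr1 addrC.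
Qed.

Lemma natr_Fp_inj : injective (fun k : 'F_p => (nat_of_ord k)%:R : E).
Proof.
move=> k l /= /eqP; wlog kl : k l / (k <= l)%N => [H e|].
  by have [|/ltnW] := leqP k l => h; [exact: H|apply/esym/H; rewrite // eq_sym].
rewrite eq_sym -subr_eq0 -natrB // -(dvdn_pcharf pE) => /dvdnP[m em].
have lp : (l < p)%N by have := ltn_ord l; rewrite [X in (_ < X)%N]Fp_cast.
apply: val_inj => /=; move: em kl lp; case: m => [|m]; rewrite ?mulSn; lia.
Qed.

Lemma toFp_natr (k : 'F_p) : toFp p ((nat_of_ord k)%:R : E) = k.
Proof.
rewrite /toFp; case: pickP => [l /eqP /natr_Fp_inj -> //|/(_ k)].
by rewrite eqxx.
Qed.

Lemma toFp_nat m : toFp p (m%:R : E) = m%:R.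
Proof. by rewrite -{1}(GRing.natr_mod_pchar pE) -val_Fp_nat // toFp_natr. Qed.

(** The images of 'F_p already exhaust the p roots of X^p - X; hence [toFp] never returns its
    default value on a trace. *)
Lemma prime_field_natr y : y ^+ p = y -> exists k : 'F_p, y = (nat_of_ord k)%:R.
Proof.
move=> yp; pose g (k : 'F_p) : E := (nat_of_ord k)%:R.
pose A := [set g k | k in 'F_p].
have cA : #|A| = p by rewrite card_imset ?card_Fp //; exact: natr_Fp_inj.
have p1 := prime_gt1 p_prime.
have sX : size ('X^p - 'X : {poly E}) = p.+1.
  by rewrite size_polyDl size_polyXn // poly.size_polyN size_polyX.
have AB : A = [set z : E | z ^+ p == z].
  apply/eqP; rewrite eqEcard; apply/andP; split.
    apply/subsetP => _ /imsetP[k _ ->]; rewrite inE -(pFrobenius_autE pE).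
    by rewrite rmorph_nat.
  rewrite cA; apply: (@leq_card_roots _ ('X^p - 'X)); rewrite ?sX // -?size_poly_gt0 ?sX //.
  by move=> z; rewrite !inE /root !hornerE subr_eq0.
have : y \in A by rewrite AB inE yp.
by case/imsetP => k _ ->; exists k.
Qed.

Definition tchar x := psi (toFp p (trFp p x)).

Lemma tcharD x y : tchar (x + y) = tchar x * tchar y.
Proof.
rewrite /tchar trFpD; have [k ->] := prime_field_natr (trFp_fixed x).
have [l ->] := prime_field_natr (trFp_fixed y).
by rewrite -natrD !toFp_nat -psi_add natrD.
Qed.

Lemma tchar_tr0 x : trFp p x = 0 -> tchar x = 1.
Proof.
move=> h; rewrite /tchar h -psi0; congr psi.
by rewrite -(toFp_natr 0) /= mulr0n.
Qed.

Lemma norm_tchar x : `|tchar x| = 1. Proof. exact: norm_psi. Qed.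

(** The terms of index j and h + j in the trace cancel. *)
Lemma trFp_half x h : logn p #|E| = (h + h)%N -> x ^+ (p ^ h) = - x -> trFp p x = 0.
Proof.
move=> eh xh; rewrite /trFp eh big_split_ord /= -big_split big1 // => j _ /=.
have -> : x ^+ (p ^ (h + j)) = - x ^+ (p ^ j).
  by rewrite expnD exprM xh exprNn_pchar // pnat_expp.
by rewrite subrr.
Qed.

Lemma exists_tchar_neq1 x : (exists a : 'F_p, psi a != 1) -> trFp p x != 0 ->
  exists k : nat, tchar (x *+ k) != 1.
Proof.
move=> [a psia] tx; have [b eb] := prime_field_natr (trFp_fixed x).
have b0 : b != 0 by apply: contra tx => /eqP b0; rewrite eb b0.
(* Multiplication by a/b moves the trace from b to a, where psi differs from 1. *)
exists (nat_of_ord (a / b)); rewrite /tchar trFpMn eb -mulrnA.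
by rewrite toFp_nat natrM !natr_Zp mulrC divfK.
Qed.

Variables (F : finFieldType) (iota : {rmorphism F -> E}) (n r : nat).
Hypotheses (n_gt0 : (0 < n)%N) (cF : #|F| = (p ^ n)%N).
Hypotheses (r_gt0 : (0 < r)%N) (cE : #|E| = ((p ^ n) ^ r)%N).

Lemma logn_cardE : logn p #|E| = (n * r)%N.
Proof. by rewrite cE -expnM pfactorK. Qed.

Lemma sum_ord_mul (y : E) : \sum_(j < n * r) y ^+ (p ^ j)
   = \sum_(l < r) \sum_(s < n) y ^+ (p ^ (s + n * l)).
Proof.
elim: r => [|m IH]; first by rewrite muln0 !big_ord0.
rewrite big_ord_recr /= -IH mulnSr big_split_ord /=; congr (_ + _).
by apply: eq_bigr => s _; rewrite addnC.
Qed.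

Lemma iota_exp (a : F) l : iota a ^+ ((p ^ n) ^ l) = iota a.
Proof. by elim: l => [|l IH]; rewrite ?expr1 // expnS mulnC exprM IH -cF -rmorphXn expf_card. Qed.

(** Transitivity of the trace: splitting the exponent as s + n l, the sum over l is the trace to
    F_q, through which the factor from F passes. *)
Lemma trFp_iotaM (a : F) (b : E) :
  trFp p (iota a * b) = \sum_(s < n) (iota a * psum 1 (traject (frob p n) b r)) ^+ (p ^ s).
Proof.
rewrite /trFp logn_cardE sum_ord_mul exchange_big; apply: eq_bigr => s _ /=.
have -> : psum 1 (traject (frob p n) b r) = \sum_(l < r) b ^+ ((p ^ n) ^ l).
  rewrite /psum; under eq_bigr do rewrite expr1.
  rewrite (big_nth b) size_traject big_mkord; apply: eq_bigr => l _.
  by rewrite nth_traject // iter_frob.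
rewrite mulr_sumr.
have -> : forall (T : Type) (u : seq T) (f : T -> E), (\sum_(i <- u) f i) ^+ (p ^ s) = \sum_(i <- u) f i ^+ (p ^ s).
  move=> T u f; elim: u => [|a0 u IH]; last by rewrite !big_cons exprDn_pchar ?pnat_expp // IH.
  by rewrite !big_nil expr0n expn_eq0 eqn0Ngt prime_gt0.
apply: eq_bigr => l _; rewrite addnC expnD exprM expnM exprMn iota_exp.
by [].
Qed.

(* The additive polynomial sum_s (T X)^(p^s) has degree < q, hence does not vanish on F. *)
Lemma exists_trFp_neq0 (b : E) : psum 1 (traject (frob p n) b r) != 0 ->
  exists a : F, trFp p (iota a * b) != 0.
Proof.
set T := psum _ _ => T0; pose Q : {poly E} := \sum_(s < n) (T ^+ (p ^ s)) *: 'X^(p ^ s).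
have p1 := prime_gt1 p_prime.
have Q0 : Q != 0.
  apply/eqP => /(congr1 (fun P : {poly E} => P`_1)); rewrite coef0 coef_sum.
  case: (n) n_gt0 => // m _; rewrite big_ord_recl big1 ?addr0 => [|s _].
    by rewrite coefZ expn0 !expr1 coefX mulr1 => /eqP; rewrite (negPf T0).
  rewrite coefZ coefXn (_ : (1 == p ^ lift ord0 s)%N = false) ?mulr0 //.
  by apply/negbTE; rewrite eq_sym -(expn0 p) eqn_exp2l.
have sQ : (size Q <= (p ^ n.-1).+1)%N.
  apply: leq_trans (size_sum _ _ _) _; apply/bigmax_leqP => s _.
  apply: leq_trans (size_scale_leq _ _) _; rewrite size_polyXn ltnS leq_exp2l //.
  by have := ltn_ord s; lia.
have [/existsP[a ha]|] := boolP [exists a : F, trFp p (iota a * b) != 0]; first by exists a.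
rewrite negb_exists => /forallP h.
have : (#|[set iota a | a : F]| <= p ^ n.-1)%N.
  apply: (leq_card_roots Q0 sQ) => _ /imsetP[a _ ->].
  have /eqP := negbNE (h a); rewrite trFp_iotaM => e.
  rewrite /root -{1}e /Q horner_sum; apply/eqP; apply: eq_bigr => s _.
  by rewrite hornerZ hornerXn exprMn mulrC.
rewrite card_imset; last exact: fmorph_inj.
by rewrite cF leqNgt ltn_exp2l // prednK // leqnn.
Qed.

End TraceCharacter.

(** * Character sums averaged over the family *)

Section AverageCharSum.
Variables (C : numFieldType) (p : nat) (psi : 'F_p -> C).
Hypotheses (p_prime : prime p) (p_gt2 : (2 < p)%N).
Hypothesis psi_add : forall a b : 'F_p, psi (a + b) = psi a * psi b.
Hypothesis psi_neq0 : forall a : 'F_p, psi a != 0.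
Hypothesis psi_nontriv : exists a : 'F_p, psi a != 1.
Variables (E F : finFieldType) (iota : {rmorphism F -> E}) (n r d : nat).
Hypotheses (pE : p \in [pchar E]).
Hypotheses (n_gt0 : (0 < n)%N) (cF : #|F| = (p ^ n)%N).
Hypotheses (r_gt0 : (0 < r)%N) (cE : #|E| = ((p ^ n) ^ r)%N).
Hypotheses (d_odd : odd d) (p_ndvd_d : ~~ (p %| d)%N).
Implicit Types (x y : E) (c : {ffun 'I_d.+1 -> F}).

Definition shift_coef (i : 'I_d.+1) (a : F) c : {ffun 'I_d.+1 -> F} :=
  [ffun j => c j + (if j == i then a else 0)].

Lemma ASpoly_shift i a c : ASpoly (shift_coef i a c) = ASpoly c + a *: 'X^i.
Proof.
apply/polyP => j; rewrite coefD coefZ coefXn !coef_poly.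
case: ltnP => [jd|dj]; last first.
  by rewrite (_ : (j == i)%N = false) ?mulr0 ?addr0 //; apply/negbTE; have := ltn_ord i; lia.
rewrite ffunE -val_eqE /= inordK //; case: eqP => _; by rewrite ?mulr1 ?mulr0.
Qed.

Lemma shift_coef_AS0odd (i : 'I_d.+1) a c : odd i -> ~~ (p %| i)%N -> (i < d)%N ->
  c \in AS0odd p F d -> shift_coef i a c \in AS0odd p F d.
Proof.
move=> oi pi id; rewrite !inE => /and3P[cm /forallP cp /eqP co]; apply/and3P; split.
- by rewrite ffunE -val_eqE /= (_ : (d == i)%N = false) ?addr0 //; apply/negbTE; lia.
- apply/forallP => j; apply/implyP => /andP[j0 pj]; rewrite ffunE.
  have /implyP/(_ _)/eqP -> := cp j; last by rewrite j0.
  by have [ji|_] := eqVneq j i; rewrite ?addr0 //; rewrite -ji pj in pi.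
- rewrite ASpoly_shift raddfD /= co opprD linearZ /=.
  have -> : ('X^i \Po - 'X : {poly F}) = - 'X^i.
    by rewrite rmorphXn /= comp_polyX exprNn -signr_odd oi expr1 mulN1r.
  by rewrite scalerN.
Qed.

Lemma shift_coefK i a : cancel (shift_coef i a) (shift_coef i (- a)).
Proof. by move=> c; apply/ffunP => j; rewrite !ffunE; case: eqP; rewrite ?addr0 // addrK. Qed.

Let f c x := (map_poly iota (ASpoly c)).[x].

Lemma psum_traject_exp x i :
  psum 1 (traject (frob p n) (x ^+ i) r) = trace_pow p n r i x.
Proof.
rewrite /trace_pow /psum (big_nth (x ^+ i)) [RHS](big_nth x) !size_traject !big_mkord.
apply: eq_bigr => l _; rewrite !nth_traject // !iter_frob expr1.
by rewrite -!exprM mulnC.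
Qed.

(** Translating the coefficient of X^i permutes the family, i < d protecting the leading
    coefficient, and multiplies the sum by a constant; the nonzero trace allows a translation for
    which this constant is not 1. *)
Lemma sum_tchar_eq0 x (i : nat) : odd i -> ~~ (p %| i)%N -> (i < d)%N ->
  trace_pow p n r i x != 0 -> \sum_(c in AS0odd p F d) tchar psi (f c x) = 0.
Proof.
move=> oi pi id; rewrite -psum_traject_exp => T0.
have [a ha] := exists_trFp_neq0 p_prime pE iota n_gt0 cF r_gt0 cE T0.
have [k hk] := exists_tchar_neq1 p_prime pE psi_nontriv ha.
have id1 : (i < d.+1)%N by rewrite ltnS ltnW.
pose h := shift_coef (Ordinal id1) (a *+ k).
set S := \sum_(c in _) _.
have : S = tchar psi ((iota a * x ^+ i) *+ k) * S.
  rewrite {1}/S (reindex_inj (can_inj (shift_coefK (Ordinal id1) (a *+ k)))) /= mulr_sumr.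
  apply: eq_big => [c|c cS].
    apply/idP/idP; last exact: shift_coef_AS0odd.
    by move=> /(shift_coef_AS0odd (- (a *+ k)) (i := Ordinal id1) oi pi id); rewrite shift_coefK.
  rewrite -(tcharD p_prime psi_add pE) /f ASpoly_shift rmorphD hornerD addrC /=.
  by rewrite map_polyZ map_polyXn hornerZ hornerXn rmorphMn mulrnAl.
move/eqP; rewrite -subr_eq0 -{1}[S]mul1r -mulrBl mulf_eq0 subr_eq0 eq_sym (negPf hk).
by move/eqP.
Qed.

Lemma horner_ASpolyN c x : c \in AS0odd p F d -> f c (- x) = - f c x.
Proof.
rewrite inE => /and3P[_ _ /eqP co]; rewrite /f.
have := congr1 (fun P => (map_poly iota P).[x]) co.
rewrite map_comp_poly !rmorphN /= map_polyX horner_comp hornerN hornerX => ->.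
by rewrite hornerN.
Qed.

Lemma iter_frob_horner c x k : iter k (frob p n) (f c x) = f c (iter k (frob p n) x).
Proof.
elim: k => [|k IH] //=; rewrite IH /f; apply: frob_horner => // i.
by rewrite coef_map /= -[frob _ _ _]/(_ ^+ _) -cF -rmorphXn expf_card.
Qed.

(** An odd f over F_q commutes with Frobenius and with negation, so the half Frobenius also sends
    f(x) to -f(x). *)
Lemma tchar_half_conj c x : half_conj p n r x -> c \in AS0odd p F d -> tchar psi (f c x) = 1.
Proof.
move=> /andP[er /eqP hx] cS; apply: (tchar_tr0 p_prime psi_add psi_neq0 pE).
apply: (@trFp_half _ _ pE _ (n * r./2)).
  by rewrite (logn_cardE p_prime cE) -mulnDr addnn; congr (_ * _)%N;
     rewrite -[LHS]odd_double_half (negPf er).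
by rewrite expnM -iter_frob iter_frob_horner hx horner_ASpolyN.
Qed.

Lemma norm_sum_tchar :
  `| \sum_(c in AS0odd p F d) \sum_(x : E) tchar psi (f c x)
     - #|AS0odd p F d|%:R * (if odd r then 0 else ((p ^ n) ^ r./2)%:R) |
  <= #|AS0odd p F d|%:R * #|bad_set E p n r d|%:R.
Proof.
set S := AS0odd p F d; rewrite exchange_big /=.
set g := fun x : E => \sum_(c in S) tchar psi (f c x).
have -> : (if odd r then 0 else ((p ^ n) ^ r./2)%:R) = #|[set x : E | half_conj p n r x]|%:R :> C.
  case: ifPn => [or|er]; last by rewrite (card_half_conj pE p_gt2 n_gt0 r_gt0 cE).
  rewrite (_ : [set x : E | _] = finset.set0) ?cards0 //.
  by apply/setP => x; rewrite !inE /half_conj or.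
have -> : #|S|%:R * #|[set x : E | half_conj p n r x]|%:R = \sum_(x : E | half_conj p n r x) #|S|%:R :> C.
  by rewrite sumr_const mulr_natr; congr (_ *+ _); rewrite cardsE.
rewrite (bigID (@half_conj E p n r)) /= addrAC -sumrB big1 => [|x hx]; last first.
  rewrite (eq_bigr (fun=> 1)) => [|c cS]; last exact: tchar_half_conj.
  by rewrite sumr_const subrr.
rewrite add0r (bigID (@odd_traces0 E p n r d)) /= [X in _ + X]big1 ?addr0 => [|x /andP[_ t]].
  apply: le_trans (ler_norm_sum _ _ _) _.
  apply: le_trans (_ : \sum_(x : E | ~~ half_conj p n r x && odd_traces0 p n r d x) #|S|%:R <= _).
    apply: ler_sum => x _; apply: le_trans (ler_norm_sum _ _ _) _.
    rewrite (eq_bigr (fun=> 1)) => [|c _]; last exact: norm_tchar.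
    by rewrite sumr_const.
  rewrite sumr_const -[X in X <= _]mulr_natr ler_wpM2l ?ler0n // ler_nat.
  by apply: subset_leq_card; apply/fintype.subsetP => x; rewrite !inE andbC.
move: t; rewrite negb_forall => /existsP[i]; rewrite negb_imply => /andP[/andP[oi pi] ti].
exact: (@sum_tchar_eq0 x i).
Qed.

Lemma card_AS0odd_gt0 : (0 < #|AS0odd p F d|)%N.
Proof.
(* The witness is the monomial X^d. *)
apply/card_gt0P; exists (shift_coef ord_max 1 [ffun=> 0]).
have E0 : ASpoly ([ffun=> 0] : {ffun 'I_d.+1 -> F}) = 0.
  by apply/polyP => j; rewrite coef_poly coef0; case: ifP => // _; rewrite ffunE.
rewrite inE; apply/and3P; split.
- by rewrite !ffunE eqxx add0r oner_eq0.
- apply/forallP => j; apply/implyP => /andP[_ pj]; rewrite !ffunE add0r.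
  by have [ej|_] := eqVneq j ord_max; rewrite ?eqxx //; rewrite ej /= (negPf p_ndvd_d) in pj.
- rewrite ASpoly_shift E0 add0r scale1r rmorphXn /= comp_polyX.
  by rewrite exprNn -signr_odd d_odd expr1 mulN1r.
Qed.

End AverageCharSum.

From mathcomp Require Import all_classical all_reals all_analysis measurable_realfun.
From mathcomp Require Import complex lra.

Import numFieldNormedType.Exports.
Local Open Scope classical_set_scope.

(** * Mean value bounds and integrals over the real line *)

Section RealIntegrals.
Variable R : realType.
Local Notation mu := (@lebesgue_measure R).
Implicit Types (f g : R -> R) (D : set R).

Lemma MVT_between f (a b : R) : (forall x, derivable f x 1) ->
  exists c, [/\ `|c - a| <= `|b - a|, `|c - b| <= `|b - a| &
                f b - f a = derive1 f c * (b - a)].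
Proof.
move=> df.
have cf : continuous f by move=> x; apply/differentiable_continuous/derivable1_diffP.
have isd (x : R) : is_derive x 1 f (derive1 f x).
  by apply: DeriveDef; rewrite ?derive1E.
have cw (A : set R) : {within A, continuous f} by apply: continuous_subspaceT.
have [ab|ba] := leP a b.
  have [c /[!in_itv]/= /andP[ac cb] e] := MVT_segment ab (fun x _ => isd x) (cw _).
  exists c; split=> //; rewrite ler_norml (ger0_norm (_ : 0 <= b - a)) ?subr_ge0 //; lra.
have [c /[!in_itv]/= /andP[ac cb] e] := MVT_segment (ltW ba) (fun x _ => isd x) (cw _).
exists c; split; last by rewrite -opprB e -mulrN opprB.
all: by rewrite ler_norml (ler0_norm (_ : b - a <= 0)); lra.
Qed.

Lemma MVT_bound f (a b M : R) : (forall x, derivable f x 1) ->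
  (forall c, `|c - a| <= `|b - a| -> `|derive1 f c| <= M) ->
  `|f b - f a| <= M * `|b - a|.
Proof.
move=> df hM; have [c [ca _ ->]] := MVT_between a b df.
by rewrite normrM ler_wpM2r // hM.
Qed.

Lemma ler_norm_sinB (a b : R) : `|sin a - sin b| <= `|a - b|.
Proof.
rewrite -[leRHS]mul1r; apply: MVT_bound => [x|c _]; first exact: derivable_sin.
by rewrite derive1E (derive_val (f := sin)) cos_max.
Qed.

Lemma ler_norm_cosB (a b : R) : `|cos a - cos b| <= `|a - b|.
Proof.
rewrite -[leRHS]mul1r; apply: MVT_bound => [x|c _]; first exact: derivable_cos.
by rewrite derive1E (derive_val (f := cos)) normrN sin_max.
Qed.

(** Linearized at b rather than at a, since [cosavg] samples at right end points. *)
Lemma sin_taylor1 (a b : R) : `|sin b - sin a - (b - a) * cos b| <= `|b - a| ^+ 2.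
Proof.
have [c [_ cb ->]] := MVT_between a b (@derivable_sin R).
rewrite derive1E (derive_val (f := sin)) mulrC -mulrBr normrM expr2 ler_wpM2l //.
exact: le_trans (ler_norm_cosB _ _) cb.
Qed.

Lemma cvg_natSinv_bound (u : nat -> R) (l C : R) :
  (forall n, `|u n - l| <= C / n.+1%:R) -> u @ \oo --> l.
Proof.
move=> h; apply/cvgrPdist_le => e e0.
have C0 : 0 < `|C| + 1 by rewrite ltr_wpDl.
have e1 := near_infty_natSinv_lt (PosNum (divr_gt0 e0 C0)).
near=> n.
rewrite distrC; apply: le_trans (h n) _.
apply: le_trans (_ : (`|C| + 1) * n.+1%:R^-1 <= _).
  by rewrite ler_wpM2r ?invr_ge0 ?ler0n // (le_trans (ler_norm _)) // lerDl.
rewrite -ler_pdivlMl // mulrC; apply: ltW.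
by near: n; exact: e1.
Unshelve. all: by end_near. Qed.

Lemma cvg_Rintegral D (f_ : nat -> R -> R) f g : measurable D ->
  (forall n, measurable_fun D (f_ n)) ->
  (forall x, D x -> f_ ^~ x @ \oo --> f x) ->
  mu.-integrable D (EFin \o g) ->
  (forall n x, D x -> `|f_ n x| <= g x) ->
  (fun n => \int[mu]_(x in D) f_ n x) @ \oo --> \int[mu]_(x in D) f x.
Proof.
move=> mD mf ff ig fg.
have mf' n : measurable_fun D (EFin \o f_ n) by apply/measurable_EFinP.
have ff' x : D x -> (fun n => (f_ n x)%:E) @ \oo --> (f x)%:E.
  by move=> Dx; apply: cvg_EFin; [near=> n; by []|exact: ff].
have fg' n x : D x -> (`|(f_ n x)%:E| <= (g x)%:E)%E by move=> Dx; rewrite lee_fin fg.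
have mF : measurable_fun D (EFin \o f) by apply: (emeasurable_fun_cvg _ _ mf' ff').
have [||iF _ h] := @dominated_convergence _ _ _ mu D mD (fun n => EFin \o f_ n)
  (EFin \o f) (EFin \o g) mf' mF _ ig.
  by apply: aeW => x; exact: ff'.
  by apply: aeW => x n; exact: fg'.
apply: fine_cvg; rewrite fineK; [exact: h|exact: integrable_fin_num].
Unshelve. all: by end_near. Qed.

Lemma integrable_oneDsqrV : mu.-integrable setT (EFin \o (fun x : R => (oneDsqr x)^-1)).
Proof.
have mf : measurable_fun [set: R] (fun x : R => (oneDsqr x)^-1).
  by apply: continuous_measurable_fun; exact: continuous_oneDsqrV.
apply/integrableP; split; first exact/measurable_EFinP.
have g0 (x : R) : 0 <= (oneDsqr x)^-1 by rewrite invr_ge0 (le_trans ler01) // oneDsqr_ge1.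
under eq_integral => x _ do rewrite /= ger0_norm ?g0 //.
rewrite ge0_symfun_integralT //; last 2 first.
  exact: continuous_oneDsqrV.
  by move=> x; rewrite /= /oneDsqr sqrrN.
rewrite -set_itvcy integral0y_oneDsqr -EFinM; exact: ltry.
Qed.

Lemma integrable_sumR D (I : Type) (s : seq I) (P : pred I) (F : I -> R -> R) : measurable D ->
  (forall i, mu.-integrable D (EFin \o F i)) ->
  mu.-integrable D (EFin \o (fun x => \sum_(i <- s | P i) F i x)).
Proof.
move=> mD iF.
have -> : EFin \o (fun x => \sum_(i <- s | P i) F i x)
    = (fun x => \sum_(i <- s | P i) (F i x)%:E)%E.
  by apply/funext => x /=; rewrite sumEFin.
by apply: integrable_sum => // i _; exact: iF.
Qed.

Lemma Rintegral_sum D (I : Type) (s : seq I) (P : pred I) (F : I -> R -> R) : measurable D ->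
  (forall i, mu.-integrable D (EFin \o F i)) ->
  \int[mu]_(x in D) (\sum_(i <- s | P i) F i x) = \sum_(i <- s | P i) \int[mu]_(x in D) F i x.
Proof.
move=> mD iF; elim: s => [|i s IH].
  rewrite big_nil; under eq_Rintegral do rewrite big_nil.
  by rewrite Rintegral_cst // mul0r.
rewrite big_cons; case: ifP => Pi; last by rewrite -IH; under eq_Rintegral do rewrite big_cons Pi.
under eq_Rintegral do rewrite big_cons Pi.
by rewrite RintegralD // ?IH //; exact: integrable_sumR.
Qed.

(** The single weight 1/(1 + x^2) serves all dominations: it is integrable over the line and
    summable over the integers. *)
Definition decays f (A : R) := forall x, `|f x| <= A * (oneDsqr x)^-1.

Lemma integrable_decays f A : continuous f -> decays f A ->
  mu.-integrable setT (EFin \o f).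
Proof.
move=> cf fA.
have h := @integrableZl _ _ _ mu _ measurableT A _ integrable_oneDsqrV.
apply: le_integrable h => //.
  by apply/measurable_EFinP; exact: continuous_measurable_fun.
move=> x _; rewrite /= lee_fin; apply: le_trans (fA x) _; exact: ler_norm.
Qed.

Definition int_oneDsqrV : R := \int[mu]_(x in setT) (oneDsqr x)^-1.

Lemma Rintegral_decays f A : continuous f -> decays f A ->
  `|\int[mu]_(x in setT) f x| <= A * int_oneDsqrV.
Proof.
move=> cf fA; have iF := integrable_decays cf fA.
apply: le_trans (le_normr_Rintegral _ iF) _ => //.
rewrite -RintegralZl //; last exact: integrable_oneDsqrV.
apply: le_Rintegral => //.
- exact: integrable_norm.
- exact: (@integrableZl _ _ _ mu _ measurableT A _ integrable_oneDsqrV).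
Qed.

End RealIntegrals.

(** * Fourier integrals and the limiting kernel *)

Section FourierSide.
Variable R : realType.
Local Notation mu := (@lebesgue_measure R).
Implicit Types (f g : R -> R).

(* The only consequences of the Schwartz property that are needed. *)
Record nice f (A : R) : Prop := Nice {
  nice_ge0 : 0 <= A;
  nice_derivable : forall x, derivable f x 1;
  nice_decays : decays f A;
  nice_deriv : decays (derive1 f) A;
  nice_moment : decays (fun x => x * f x) A }.

Lemma schwartz_nice f : schwartz f -> exists A, nice f A.
Proof.
move=> [df bf].
have b2 (m n : nat) : exists A, forall x, `|x ^+ m * derive1n n f x| <= A * (oneDsqr x)^-1.
  have [M1 h1] := bf m n; have [M2 h2] := bf m.+2 n.
  (* The moments of exponents m and m + 2 together bound the product with 1 + x^2. *)
  exists (M1 + M2) => x; rewrite ler_pdivlMr; last by rewrite (lt_le_trans ltr01) // oneDsqr_ge1.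
  rewrite /oneDsqr mulrDr mulr1 lerD // -(ger0_norm (sqr_ge0 x)) -normrM.
  apply: le_trans (h2 x); rewrite le_eqVlt; apply/orP; left; apply/eqP; congr (`|_|); rewrite !exprS; ring.
have [A1 h1] := b2 0%N 0%N; have [A2 h2] := b2 0%N 1%N; have [A3 h3] := b2 1%N 0%N.
have w (x : R) : 0 <= (oneDsqr x)^-1 by rewrite invr_ge0 (le_trans ler01) // oneDsqr_ge1.
exists (`|A1| + `|A2| + `|A3|); split.
- by rewrite !addr_ge0.
- by move=> x; have := df 0%N x.
- move=> x; have := h1 x; rewrite expr0 mul1r => /le_trans; apply; rewrite ler_wpM2r //.
  by have := ler_norm A1; have := normr_ge0 A2; have := normr_ge0 A3; lra.
- move=> x; have := h2 x; rewrite expr0 mul1r => /le_trans; apply; rewrite ler_wpM2r //.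
  by have := ler_norm A2; have := normr_ge0 A1; have := normr_ge0 A3; lra.
- move=> x; have := h3 x; rewrite expr1 => /le_trans; apply; rewrite ler_wpM2r //.
  by have := ler_norm A3; have := normr_ge0 A2; have := normr_ge0 A1; lra.
Qed.

Lemma nice_continuous f A : nice f A -> continuous f.
Proof. by case=> _ df _ _ _ x; apply/differentiable_continuous/derivable1_diffP. Qed.

(** For real f the Fourier transform at tau is [cosint f tau] - i [sinint f tau]. *)
Definition cosint f (tau : R) : R := \int[mu]_(t in setT) (f t * cos (2 * pi * tau * t)).
Definition sinint f (tau : R) : R := \int[mu]_(t in setT) (f t * sin (2 * pi * tau * t)).

Lemma continuous_mulcos f (w : R -> R) : continuous f -> continuous w ->
  continuous (fun t => f t * cos (w t)).
Proof.
move=> cf cw t; apply: cvgM; first exact: cf.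
by apply: continuous_comp; [exact: cw|exact: continuous_cos].
Qed.

Lemma continuous_mulsin f (w : R -> R) : continuous f -> continuous w ->
  continuous (fun t => f t * sin (w t)).
Proof.
move=> cf cw t; apply: cvgM; first exact: cf.
by apply: continuous_comp; [exact: cw|exact: continuous_sin].
Qed.

Lemma continuous_scale (a : R) : continuous (fun t : R => a * t).
Proof. by move=> t; apply: cvgM; [exact: cvg_cst|exact: cvg_id]. Qed.

Lemma decays_mul f A (g : R -> R) (B : R) : decays f A -> (forall x, `|g x| <= B) ->
  decays (fun x => f x * g x) (A * B).
Proof.
move=> hf hg x; rewrite normrM mulrAC; apply: ler_pM => //.
Qed.

Lemma integrable_mul f A (g : R -> R) (B : R) : nice f A -> continuous g ->
  (forall x, `|g x| <= B) -> mu.-integrable setT (EFin \o (fun x => f x * g x)).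
Proof.
move=> nf cg hg; apply: integrable_decays (decays_mul (nice_decays nf) hg).
by move=> t; apply: cvgM; [exact: (nice_continuous nf)|exact: cg].
Qed.

Lemma continuous_coslin (a : R) : continuous (fun t : R => cos (a * t)).
Proof. by move=> t; apply: continuous_comp; [exact: continuous_scale|exact: continuous_cos]. Qed.

Lemma continuous_sinlin (a : R) : continuous (fun t : R => sin (a * t)).
Proof. by move=> t; apply: continuous_comp; [exact: continuous_scale|exact: continuous_sin]. Qed.

Lemma continuous_sum (I : Type) (s : seq I) (P : pred I) (F : I -> R -> R) :
  (forall i, continuous (F i)) -> continuous (fun t => \sum_(i <- s | P i) F i t).
Proof.
move=> cF; elim: s => [|i s IH] t.
  by under eq_fun do rewrite big_nil; exact: cvg_cst.
have -> : (fun u => \sum_(j <- i :: s | P j) F j u)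
    = (if P i then fun u => F i u + \sum_(j <- s | P j) F j u
       else fun u => \sum_(j <- s | P j) F j u).
  by case: ifP => Pi; apply/funext => u; rewrite big_cons Pi.
by case: (P i); [apply: cvgD; [exact: cF|exact: IH]|exact: IH].
Qed.

Lemma integrable_mulcos f A (a : R) : nice f A ->
  mu.-integrable setT (EFin \o (fun x => f x * cos (a * x))).
Proof.
by move=> nf; apply: (integrable_mul nf (B := 1)) => [|x]; [exact: continuous_coslin|exact: cos_max].
Qed.

Lemma integrable_mulsin f A (a : R) : nice f A ->
  mu.-integrable setT (EFin \o (fun x => f x * sin (a * x))).
Proof.
by move=> nf; apply: (integrable_mul nf (B := 1)) => [|x]; [exact: continuous_sinlin|exact: sin_max].
Qed.

Lemma cosint_bound f A tau : nice f A -> `|cosint f tau| <= A * int_oneDsqrV R.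
Proof.
move=> nf; apply: Rintegral_decays.
  by apply: continuous_mulcos (nice_continuous nf) (@continuous_scale _).
by rewrite -[A]mulr1; apply: decays_mul (nice_decays nf) _ => x; exact: cos_max.
Qed.

Lemma sinint_bound f A tau : nice f A -> `|sinint f tau| <= A * int_oneDsqrV R.
Proof.
move=> nf; apply: Rintegral_decays.
  by apply: continuous_mulsin (nice_continuous nf) (@continuous_scale _).
by rewrite -[A]mulr1; apply: decays_mul (nice_decays nf) _ => x; exact: sin_max.
Qed.

Lemma decays_diff f A (g : R -> R) (a b : R) : nice f A ->
  (forall x y : R, `|g x - g y| <= `|x - y|) ->
  decays (fun x => f x * g (a * x) - f x * g (b * x)) (`|a - b| * A).
Proof.
move=> nf lg x; rewrite -mulrBr normrM.
apply: le_trans (_ : `|f x| * `|a * x - b * x| <= _); first by rewrite ler_wpM2l.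
rewrite -mulrBl normrM mulrCA -mulrA ler_wpM2l // -normrM mulrC.
exact: (nice_moment nf).
Qed.

(** The moment clause of [nice] bounds the derivative in tau under the integral. Applied from the
    edge of the support, where the transform is 0, this is its first order vanishing. *)
Lemma cosint_lip f A t1 t2 : nice f A ->
  `|cosint f t1 - cosint f t2| <= `|2 * pi * t1 - 2 * pi * t2| * A * int_oneDsqrV R.
Proof.
move=> nf; rewrite /cosint -RintegralB //; try exact: (integrable_mulcos _ nf).
apply: Rintegral_decays; last by apply: decays_diff => // x y; exact: ler_norm_cosB.
by move=> x; apply: cvgB; apply: (continuous_mulcos (nice_continuous nf) (@continuous_scale _)).
Qed.

Lemma sinint_lip f A t1 t2 : nice f A ->
  `|sinint f t1 - sinint f t2| <= `|2 * pi * t1 - 2 * pi * t2| * A * int_oneDsqrV R.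
Proof.
move=> nf; rewrite /sinint -RintegralB //; try exact: (integrable_mulsin _ nf).
apply: Rintegral_decays; last by apply: decays_diff => // x y; exact: ler_norm_sinB.
by move=> x; apply: cvgB; apply: (continuous_mulsin (nice_continuous nf) (@continuous_scale _)).
Qed.

(** Right Riemann sum of cos(2 pi u t) for u in [0, 1], whose integral is sin(2 pi t)/(2 pi t). *)
Definition cosavg (M : nat) (t : R) : R :=
  M%:R^-1 * \sum_(1 <= s < M.+1) cos (2 * pi * (s%:R / M%:R) * t).

Lemma cosavg_bound M t : `|cosavg M t| <= 1.
Proof.
rewrite /cosavg normrM normfV (ger0_norm (ler0n _ _)).
case: M => [|M]; first by rewrite big_geq // normr0 mulr0.
rewrite ler_pdivrMl ?ltr0n // mulr1.
apply: le_trans (ler_norm_sum _ _ _) _.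
apply: le_trans (_ : \sum_(1 <= s < M.+2) 1 <= _); first by apply: ler_sum => s _; exact: cos_max.
by rewrite sumr_const_nat subn1.
Qed.

Lemma cosavg_cvg t : (fun M => 1 - cosavg M.+1 t) @ \oo --> sinc_kernel t.
Proof.
rewrite /sinc_kernel; case: ifPn => [/eqP ->|t0].
  (* At t = 0 the average is exactly 1, in agreement with the value 0 chosen in [sinc_kernel]. *)
  have -> : (fun M => 1 - cosavg M.+1 0) = (fun=> 0).
    apply/funext => M; rewrite /cosavg; under eq_bigr do rewrite mulr0 cos0.
    by rewrite sumr_const_nat subn1 /= mulVf ?pnatr_eq0 // subrr.
  exact: cvg_cst.
apply: cvgB; first exact: cvg_cst.
set w := 2 * pi * t; have w0 : w != 0 by rewrite /w !mulf_neq0 // gt_eqF // pi_gt0.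
apply: (@cvg_natSinv_bound _ _ _ `|w|) => M.
pose h := w / M.+1%:R.
have M0 : M.+1%:R != 0 :> R by rewrite pnatr_eq0.
(* sin w telescopes over the nodes s h; each increment differs from h cos((s+1) h) by at most h^2,
   in total w^2/(M+1). *)
have E1 : sin w = \sum_(0 <= s < M.+1) (sin (s.+1%:R * h) - sin (s%:R * h)).
  by rewrite telescope_sumr // mul0r sin0 subr0 /h mulrC divfK.
have E2 : w * cosavg M.+1 t = \sum_(0 <= s < M.+1) (h * cos (s.+1%:R * h)).
  rewrite /cosavg big_add1 /= mulrA -mulr_sumr -/h; congr (_ * _).
  apply: eq_bigr => s _; congr cos; rewrite /h /w; field.
  by rewrite addrC natr1.
have : `|sin w - w * cosavg M.+1 t| <= `|w| ^+ 2 / M.+1%:R.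
  rewrite E1 E2 -sumrB; apply: le_trans (ler_norm_sum _ _ _) _.
  apply: le_trans (_ : \sum_(0 <= s < M.+1) `|h| ^+ 2 <= _).
    apply: ler_sum => s _; have := sin_taylor1 (s%:R * h) (s.+1%:R * h).
    by rewrite -mulrBl -natrB // subSnn mul1r.
  rewrite sumr_const_nat subn0 -[_ *+ M.+1]mulr_natr /h normrM normfV (ger0_norm (ler0n _ M.+1)).
  by rewrite le_eqVlt; apply/orP; left; apply/eqP; field; rewrite addrC natr1.
move=> H; rewrite -(ler_pM2l (_ : 0 < `|w|)) ?normr_gt0 // -normrM mulrBr [w * (_ / w)]mulrC divfK //.
by rewrite distrC [leRHS]mulrA -[`|w| * `|w|]expr2.
Qed.

(** The Riemann sum of the transform is moved under the integral, where the kernels [1 - cosavg] are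
    bounded by 2 and converge pointwise. *)
Lemma sinc_integral_cvg f A : nice f A ->
  (fun M => cosint f 0 - M.+1%:R^-1 * \sum_(1 <= s < M.+2) cosint f (s%:R / M.+1%:R)) @ \oo -->
  \int[mu]_(t in setT) (f t * sinc_kernel t).
Proof.
move=> nf; have cf := nice_continuous nf.
have cc M : continuous (fun t => 1 - cosavg M t).
  move=> t; apply: cvgB; first exact: cvg_cst.
  apply: cvgM; first exact: cvg_cst.
  by apply: continuous_sum => s; exact: continuous_coslin.
have E M : cosint f 0 - M.+1%:R^-1 * \sum_(1 <= s < M.+2) cosint f (s%:R / M.+1%:R)
     = \int[mu]_(t in setT) (f t * (1 - cosavg M.+1 t)).
  rewrite /cosint -Rintegral_sum //; last by move=> s; exact: integrable_mulcos nf.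
  rewrite -RintegralZl //; last first.
    by apply: integrable_sumR => // s; exact: integrable_mulcos nf.
  rewrite -RintegralB //; last 2 first.
  - exact: integrable_mulcos nf.
  - apply: (@integrableZl _ _ _ mu _ measurableT _ (EFin \o _)).
    by apply: integrable_sumR => // s; exact: integrable_mulcos nf.
  apply: eq_Rintegral => t _; rewrite mulr0 mul0r cos0 mulr1 mulrBr mulr1; congr (_ - _).
  by rewrite -mulr_sumr /cosavg; ring.
under eq_fun do rewrite E.
apply: (@cvg_Rintegral _ _ _ _ (fun t => 2 * (A * (oneDsqr t)^-1))) => //.
- move=> M; apply: continuous_measurable_fun => t; apply: cvgM; [exact: cf|exact: cc].
- move=> t _; apply: cvgM; first exact: cvg_cst.
  exact: cosavg_cvg.
- have := @integrableZl _ _ _ mu _ measurableT (2 * A) _ (@integrable_oneDsqrV R).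
  apply: eq_integrable => // t _ /=; by rewrite -EFinM mulrA.
- move=> M t _; rewrite normrM mulrC; apply: ler_pM => //; last exact: nice_decays nf t.
  by apply: le_trans (ler_normB _ _) _; rewrite normr1; have := cosavg_bound M.+1 t; lra.
Qed.

End FourierSide.

(** * The Fejer kernel *)

Section FejerKernel.
Variable R : realType.
Implicit Types (y a : R).

Definition dirichlet (j : nat) y : R :=
  1 + 2 * \sum_(1 <= k < j.+1) cos (k%:R * (2 * pi * y)).

(** K times the usual Fejer kernel, with period 1 in y. *)
Definition fejer (K : nat) y : R := \sum_(0 <= j < K) dirichlet j y.

Lemma cosD2pin a n : cos (a + n%:R * (2 * pi)) = cos a.
Proof.
elim: n => [|n IH]; first by rewrite mul0r addr0.
have -> : a + n.+1%:R * (2 * pi) = a + n%:R * (2 * pi) + pi *+ 2.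
  by rewrite -natr1 -[pi *+ 2]mulr_natl; ring.
by rewrite cosD2pi IH.
Qed.

Lemma sin_natpi n : sin (n%:R * pi) = 0 :> R.
Proof.
elim: n => [|n IH]; first by rewrite mul0r sin0.
by rewrite -natr1 mulrDl mul1r sinDpi IH oppr0.
Qed.

Lemma dirichletD1 j y n : dirichlet j (y + n%:R) = dirichlet j y.
Proof.
rewrite /dirichlet; congr (1 + 2 * _); apply: eq_bigr => k _.
rewrite -(cosD2pin (k%:R * (2 * pi * y)) (k * n)); congr cos.
by rewrite natrM; ring.
Qed.

Lemma fejerD K y n : fejer K (y + n%:R) = fejer K y.
Proof. by apply: eq_bigr => j _; rewrite dirichletD1. Qed.

Lemma fejerB K y n : fejer K (y - n%:R) = fejer K y.
Proof. by rewrite -[in RHS](subrK n%:R y) fejerD. Qed.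

Lemma dirichletS j y :
  dirichlet j.+1 y = dirichlet j y + 2 * cos (j.+1%:R * (2 * pi * y)).
Proof. by rewrite /dirichlet big_nat_recr //= mulrDr addrA. Qed.

Lemma sin_dirichlet j y : sin (pi * y) * dirichlet j y = sin ((2 * j%:R + 1) * (pi * y)).
Proof.
elim: j => [|j IH].
  by rewrite /dirichlet big_geq // !mulr0 addr0 mulr1 add0r mul1r.
rewrite dirichletS mulrDr IH.
set x := pi * y.
have -> : (2 * j%:R + 1) * x = j.+1%:R * (2 * pi * y) - x by rewrite /x -natr1; ring.
have -> : (2 * j.+1%:R + 1) * x = j.+1%:R * (2 * pi * y) + x by rewrite /x; ring.
by rewrite sinB sinD; ring.
Qed.

(** The closed formula sin(pi K y)^2 / sin(pi y)^2 in product form, valid also at the integers. *)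
Lemma sin_fejer K y : sin (pi * y) ^+ 2 * fejer K y = sin (K%:R * (pi * y)) ^+ 2.
Proof.
elim: K => [|K IH]; first by rewrite /fejer big_geq // mulr0 mul0r sin0 expr0n.
rewrite /fejer big_nat_recr //= mulrDr -/(fejer K y) IH expr2 -mulrA sin_dirichlet.
set x := pi * y.
have -> : (2 * K%:R + 1) * x = K%:R * x + K.+1%:R * x by rewrite -natr1; ring.
have E : K.+1%:R * x = K%:R * x + x by rewrite -natr1 mulrDl mul1r.
rewrite E !sinD !cosD.
set s := sin (K%:R * x); set c := cos (K%:R * x).
have hc : c ^+ 2 = 1 - s ^+ 2 by rewrite /c /s cos2sin2.
have hx : cos x ^+ 2 = 1 - sin x ^+ 2 by rewrite cos2sin2.
have -> : s ^+ 2 + sin x * (s * (c * cos x - s * sin x) + c * (s * cos x + c * sin x))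
  = s ^+ 2 - s ^+ 2 * sin x ^+ 2 + 2 * sin x * s * c * cos x + sin x ^+ 2 * c ^+ 2 by ring.
have -> : (s * cos x + c * sin x) ^+ 2 = s ^+ 2 * cos x ^+ 2 + 2 * sin x * s * c * cos x
  + c ^+ 2 * sin x ^+ 2 by ring.
by rewrite hx; ring.
Qed.

Lemma norm_sin_natM K a : `|sin (K%:R * a)| <= K%:R * `|sin a|.
Proof.
elim: K => [|K IH]; first by rewrite !mul0r sin0 normr0.
rewrite -natr1 !mulrDl !mul1r sinD.
apply: le_trans (ler_normD _ _) _; rewrite !normrM; apply: lerD.
  by apply: le_trans IH; rewrite -[leRHS]mulr1 ler_wpM2l // cos_max.
by rewrite -[leRHS]mul1r ler_wpM2r // cos_max.
Qed.

(** From sin(a/2) >= (a/2) cos(a/2), by the mean value theorem, sin a >= a cos(a/2)^2 = a (1 + cos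
    a)/2 >= a/2. *)
Lemma sin_ge_half a : 0 <= a <= pi / 2 -> a / 2 <= sin a.
Proof.
move=> /andP[a0 api]; have pi0 := @pi_gt0 R.
have hq : 2^-1 <= cos (a / 2) ^+ 2.
  have -> : cos (a / 2) ^+ 2 = (cos a + 1) / 2.
    have := cos_mulr2n (a / 2); rewrite -[a / 2 *+ 2]mulr_natr divfK ?pnatr_eq0 // => ->.
    by field.
  have : 0 <= cos a by apply: cos_ge0_pihalf; lra.
  lra.
have h2 : a / 2 * cos (a / 2) <= sin (a / 2).
  have [c [c0 ca e]] := MVT_between 0 (a / 2) (@derivable_sin R).
  move: e; rewrite sin0 !subr0 derive1E (derive_val (f := sin)) => ->; rewrite mulrC.
  rewrite ler_wpM2r; [by []|lra|].
  move: c0; rewrite !subr0 (ger0_norm (_ : 0 <= a / 2)); last lra.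
  rewrite -(cos_norm c) => c0.
  have [->|nc] := eqVneq `|c| (a / 2); first by [].
  have i1 : `|c| \in `[0, pi]%R by rewrite in_itv /= normr_ge0 /=; lra.
  have i2 : a / 2 \in `[0, pi]%R by rewrite in_itv /=; lra.
  by apply: ltW; rewrite ltr_cos // lt_neqAle nc c0.
have -> : sin a = 2 * (cos (a / 2) * sin (a / 2)).
  have := sin_mulr2n (a / 2); rewrite -[a / 2 *+ 2]mulr_natr divfK ?pnatr_eq0 // => ->.
  by rewrite -mulr_natl.
have c0 : 0 <= cos (a / 2) by apply: cos_ge0_pihalf; lra.
have : cos (a / 2) * (a / 2 * cos (a / 2)) <= cos (a / 2) * sin (a / 2) by rewrite ler_wpM2l.
have -> : cos (a / 2) * (a / 2 * cos (a / 2)) = a / 2 * cos (a / 2) ^+ 2 by ring.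
move=> h3; have : a / 2 * 2^-1 <= a / 2 * cos (a / 2) ^+ 2 by rewrite ler_wpM2l //; lra.
lra.
Qed.

Lemma norm_sinpi_ge y : `|y| <= 2^-1 -> `|y| <= `|sin (pi * y)|.
Proof.
move=> hy; have pi2 := @pi_ge2 R.
have E : `|sin (pi * y)| = sin (pi * `|y|).
  have [y0|y0] := leP 0 y.
    rewrite !ger0_norm //; last by apply: sin_ge0_pi; rewrite ger0_norm // in hy; nra.
  rewrite (ltr0_norm y0) mulrN sinN ler0_norm //.
  have : 0 <= sin (pi * - y) by apply: sin_ge0_pi; rewrite ltr0_norm // in hy; nra.
  by rewrite mulrN sinN; lra.
rewrite E; apply: le_trans (sin_ge_half _); have := normr_ge0 y; nra.
Qed.

(** After division by K this dominates the first moment of the kernel uniformly in K; [fejer_bound2]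
    makes the same quantity tend to 0 at each y. *)
Lemma fejer_bound K y : `|y| <= 2^-1 -> `|y| * `|fejer K y| <= K%:R.
Proof.
move=> hy; have [->|y0] := eqVneq y 0; first by rewrite normr0 mul0r ler0n.
have ys := norm_sinpi_ge hy; have y1 : 0 < `|y| by rewrite normr_gt0.
have s0 : 0 < `|sin (pi * y)| by apply: lt_le_trans ys.
have : `|sin (pi * y)| * (`|sin (pi * y)| * `|fejer K y|) <= `|sin (pi * y)| * K%:R.
  rewrite mulrA -expr2 -normrX -normrM sin_fejer normrX expr2.
  rewrite [leRHS]mulrC; apply: le_trans (norm_sin_natM _ _).
  by rewrite -[leRHS]mulr1 ler_wpM2l // sin_max.
rewrite ler_pM2l // => h; apply: le_trans h; by rewrite ler_wpM2r.
Qed.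

Lemma fejer_bound2 K y : `|y| <= 2^-1 -> y != 0 -> `|y| * `|fejer K y| <= `|y|^-1.
Proof.
move=> hy y0; have ys := norm_sinpi_ge hy; have y1 : 0 < `|y| by rewrite normr_gt0.
rewrite -(ler_pM2l y1) mulfV ?gt_eqF // mulrA -expr2.
apply: le_trans (_ : `|sin (pi * y)| ^+ 2 * `|fejer K y| <= _).
  by rewrite ler_wpM2r // lerXn2r // nnegrE.
rewrite -normrX -normrM sin_fejer normrX.
by rewrite expr_le1 // sin_max.
Qed.

Lemma continuous_dirichlet j : continuous (dirichlet j).
Proof.
move=> y; apply: cvgD; first exact: cvg_cst.
apply: cvgM; first exact: cvg_cst.
apply: continuous_sum => k {}y; apply: continuous_comp; last exact: continuous_cos.
by apply: cvgM; [exact: cvg_cst|exact: continuous_scale].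
Qed.

Lemma continuous_fejer K : continuous (fejer K).
Proof. by apply: continuous_sum => j; exact: continuous_dirichlet. Qed.

Lemma dirichlet_max j y : `|dirichlet j y| <= 1 + 2 * j%:R.
Proof.
apply: le_trans (ler_normD _ _) _; rewrite normr1 lerD2l normrM (ger0_norm (ler0n _ 2)).
rewrite ler_wpM2l ?ler0n //; apply: le_trans (ler_norm_sum _ _ _) _.
apply: le_trans (_ : \sum_(1 <= k < j.+1) 1 <= _); first by apply: ler_sum => s _; exact: cos_max.
by rewrite sumr_const_nat subn1.
Qed.

End FejerKernel.

(** * Integrals over one period *)

Section CompactIntegrals.
Variable R : realType.
Local Notation mu := (@lebesgue_measure R).
Implicit Types (h : R -> R) (a b c : R).

Lemma integrable_itv h a b : continuous h -> mu.-integrable `[a, b] (EFin \o h).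
Proof.
move=> ch; apply: continuous_compact_integrable; first exact: segment_compact.
exact: continuous_subspaceT.
Qed.

Lemma Rintegral_split h a b c : continuous h -> a <= b -> b <= c ->
  \int[mu]_(x in `[a, c]) h x = \int[mu]_(x in `[a, b]) h x + \int[mu]_(x in `[b, c]) h x.
Proof.
move=> ch ab bc.
have := @Rintegral_itvB R h (BLeft a) (BRight c) b (integrable_itv a c ch).
rewrite !bnd_simp => /(_ ab bc); rewrite Rintegral_itv_obnd_cbnd.
  by move=> <-; rewrite addrC subrK.
apply: integrableS (integrable_itv b c ch) => //.
exact: subset_itv_oc_cc.
Qed.

Lemma Rintegral_shift h a b c : a <= b -> continuous h ->
  \int[mu]_(x in `[c + a, c + b]) h x = \int[mu]_(x in `[a, b]) h (c + x).
Proof.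
move=> ab ch; pose F (x : R) := c + x.
have dF (x : R) : is_derive x 1 F 1.
  by rewrite -[X in is_derive _ _ _ X]add0r /F; apply: is_deriveD.
have F' : derive1 F = cst 1 by apply/funext => x; rewrite derive1E (derive_val (f := F)).
rewrite /Rintegral; congr fine.
have := @integration_by_substitution_increasing R F h a b ab.
rewrite F' /F => ->.
- by apply: eq_integral => x _; rewrite /= /GRing.mul /= mulr1.
- by move=> x y _ _; rewrite ltrD2l.
- by move=> x _; exact: cst_continuous.
- exact: is_cvg_cst.
- exact: is_cvg_cst.
- split.
  + by move=> x _; have [] := dF x.
  + by apply: cvg_at_right_filter; apply: cvgD; [exact: cvg_cst|exact: cvg_id].
  + by apply: cvg_at_left_filter; apply: cvgD; [exact: cvg_cst|exact: cvg_id].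
- exact: continuous_subspaceT.
Qed.

Lemma Rintegral_cos_period a b : a != 0 -> sin (a * b) = 0 -> 0 < b ->
  \int[mu]_(x in `[- b, b]) cos (a * x) = 0.
Proof.
move=> a0 sab b0; pose F (x : R) := a^-1 * sin (a * x).
have dF (x : R) : is_derive x 1 F (cos (a * x)).
  have h1 : is_derive x 1 (fun x : R => a * x) a.
    by rewrite -[X in is_derive _ _ _ X]mulr1; apply: is_deriveZ.
  have h2 : is_derive x 1 (fun x : R => sin (a * x)) (a * cos (a * x)).
    rewrite mulrC; exact: (@is_derive1_comp R sin (fun x => a * x) x _ _ (is_derive_sin _) h1).
  rewrite -[X in is_derive _ _ _ X](mulKf a0); exact: is_deriveZ.
have cF : continuous F by move=> x; apply/differentiable_continuous/derivable1_diffP; have [] := dF x.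
rewrite /Rintegral (@continuous_FTC2 R (fun x => cos (a * x)) F) //=.
- by rewrite /F mulrN sinN sab oppr0 !mulr0 subrr.
- by rewrite gtrN.
- exact/continuous_subspaceT/continuous_coslin.
- split.
  + by move=> x _; have [] := dF x.
  + by apply: cvg_at_right_filter; exact: cF.
  + by apply: cvg_at_left_filter; exact: cF.
- by move=> x _; rewrite derive1E (derive_val (f := F)).
Qed.

Variable N : nat.
Hypothesis N_gt0 : (0 < N)%N.
Let hN : R := N%:R / 2.

Lemma hN_gt0 : 0 < hN. Proof. by rewrite /hN divr_gt0 ?ltr0n. Qed.

Lemma continuous_divN h : continuous h -> continuous (fun s : R => h (s / N%:R)).
Proof.
move=> ch s; apply: continuous_comp; last exact: ch.
by apply: cvgM; [exact: cvg_id|exact: cvg_cst].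
Qed.

Lemma Rintegral_itv_cst (r : R) : \int[mu]_(x in `[- hN, hN]) r = r * N%:R.
Proof.
rewrite Rintegral_cst //; congr (_ * _).
have := @lebesgue_measure_itv R `[- hN, hN]%R; rewrite /= lte_fin gtrN ?hN_gt0 // => ->.
by rewrite -EFinD /= opprK /hN; field.
Qed.

Lemma Rintegral_dirichlet j : \int[mu]_(s in `[- hN, hN]) dirichlet j (s / N%:R) = N%:R.
Proof.
have N0 : N%:R != 0 :> R by rewrite pnatr_eq0 -lt0n.
rewrite /dirichlet.
have ci k : continuous (fun s : R => cos (k%:R * (2 * pi * (s / N%:R)))).
  have -> : (fun s : R => cos (k%:R * (2 * pi * (s / N%:R)))) = (fun s => cos ((k%:R * (2 * pi) / N%:R) * s)).
    by apply/funext => s; congr cos; field.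
  exact: continuous_coslin.
rewrite RintegralD //; last 2 first.
- by apply: integrable_itv => x; exact: cvg_cst.
- apply: integrable_itv => x; apply: cvgM; first exact: cvg_cst.
  exact: continuous_sum.
rewrite Rintegral_itv_cst mul1r RintegralZl //; last exact/integrable_itv/continuous_sum.
rewrite Rintegral_sum //; last by move=> k; exact: integrable_itv.
rewrite big_nat_cond big1 ?mulr0 ?addr0 // => k /andP[/andP[k1 _] _].
have -> : \int[mu]_(s in `[- hN, hN]) cos (k%:R * (2 * pi * (s / N%:R)))
    = \int[mu]_(s in `[- hN, hN]) cos ((k%:R * (2 * pi) / N%:R) * s).
  by apply: eq_Rintegral => s _; congr cos; field.
have pi0 : pi != 0 :> R by rewrite gt_eqF // pi_gt0.
apply: Rintegral_cos_period; last exact: hN_gt0.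
  by rewrite !mulf_neq0 // ?invr_eq0 // pnatr_eq0 -lt0n.
rewrite (_ : _ * hN = k%:R * pi) ?sin_natpi // /hN; field.
exact: N0.
Qed.

Lemma Rintegral_fejer K : \int[mu]_(s in `[- hN, hN]) fejer K (s / N%:R) = K%:R * N%:R.
Proof.
rewrite /fejer Rintegral_sum //; last first.
  by move=> j; apply/integrable_itv/continuous_divN/continuous_dirichlet.
under eq_bigr do rewrite Rintegral_dirichlet.
by rewrite sumr_const_nat subn0 -[LHS]mulr_natl.
Qed.

(** Concentration of the kernel at 0 in the form used with a Lipschitz function. Dominated
    convergence with the constant N replaces an explicit rate. *)
Lemma fejer_moment_cvg :
  (fun K => \int[mu]_(s in `[- hN, hN]) (`|s| * `|fejer K (s / N%:R)| / K%:R)) @ \oo --> (0 : R).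
Proof.
have N0 : 0 < N%:R :> R by rewrite ltr0n.
have E0 : \int[mu]_(s in `[- hN, hN]) (0 : R) = 0 by rewrite Rintegral_cst // mul0r.
have sy s : s \in `[- hN, hN]%R -> `|s / N%:R| <= 2^-1.
  rewrite in_itv /= => hs; rewrite normrM normfV (gtr0_norm N0) ler_pdivrMr // mulrC.
  by rewrite ler_norml.
rewrite -[X in _ --> X]E0.
apply: (@cvg_Rintegral _ _ _ _ (fun s => N%:R)) => //.
- move=> K; apply: measurable_funTS; apply: continuous_measurable_fun => s.
  apply: cvgM; last exact: cvg_cst.
  apply: cvgM; first exact: norm_continuous.
  by apply: cvg_norm; apply: (continuous_divN (@continuous_fejer R K)).
- move=> s hs; have [->|s0] := eqVneq s 0.
    by under eq_fun do rewrite normr0 !mul0r; exact: cvg_cst.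
  have y0 : s / N%:R != 0 by rewrite mulf_neq0 // invr_eq0 gt_eqF.
  rewrite -(cvg_shiftS (fun K => _)) /=.
  apply: (@cvg_natSinv_bound _ _ _ (N%:R * `|s / N%:R|^-1)) => K.
  rewrite subr0 normrM normfV (ger0_norm (ler0n _ K.+1)) ler_wpM2r ?invr_ge0 ?ler0n //.
  rewrite ger0_norm ?mulr_ge0 // -[in X in X * _](divfK (lt0r_neq0 N0) s) normrM (gtr0_norm N0).
  rewrite mulrAC mulrC ler_wpM2l ?(ltW N0) //.
  exact: fejer_bound2 (sy _ hs) y0.
- by apply: integrable_itv => x; exact: cvg_cst.
- move=> K s hs; rewrite normrM normfV (ger0_norm (ler0n _ K)).
  case: K => [|K]; first by rewrite invr0 mulr0 (ltW N0).
  rewrite ler_pdivrMr ?ltr0n // ger0_norm ?mulr_ge0 //.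
  rewrite -[in X in X * _ <= _](divfK (lt0r_neq0 N0) s) normrM (gtr0_norm N0) mulrAC mulrC ler_wpM2l ?(ltW N0) //.
  exact: fejer_bound (sy _ hs).
Qed.

End CompactIntegrals.

(** * Poisson summation *)

Section PoissonSummation.
Variable R : realType.
Local Notation mu := (@lebesgue_measure R).

Lemma cvg_ge_lim (v : nat -> R) (x l : R) (N : nat) : v @ \oo --> l ->
  (forall K, (N <= K)%N -> x <= v K) -> x <= l.
Proof.
move=> vl h; rewrite leNgt; apply/negP => lx.
near \oo => K.
have : v K < x by near: K; exact: (cvgr_lt l vl x lx).
rewrite ltNge h //; near: K; exact: nbhs_infty_ge.
Unshelve. all: by end_near. Qed.

Lemma cvg_le_lim (v : nat -> R) (x l : R) : v @ \oo --> l ->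
  (forall K, v K <= x) -> l <= x.
Proof.
move=> vl h; rewrite -lerN2; apply: (@cvg_ge_lim (fun K => - v K) _ _ 0%N).
  exact: cvgN.
by move=> K _; rewrite lerN2.
Qed.

Lemma sum_oneDsqrV_le4 m : \sum_(0 <= n < m) (oneDsqr (n%:R : R))^-1 <= 4.
Proof.
(* The inequality (x + 1)(x + 2) <= 4 (1 + x^2) makes the sum telescope. *)
have h (x : R) : 0 <= x -> (oneDsqr x)^-1 <= 4 * ((x + 1)^-1 - (x + 2)^-1).
  move=> x0; have -> : 4 * ((x + 1)^-1 - (x + 2)^-1) = 4 / ((x + 1) * (x + 2)).
    by field; apply/andP; split; apply: lt0r_neq0; lra.
  rewrite ler_pdivlMr; last by nra.
  rewrite ler_pdivrMl; rewrite /oneDsqr; nra.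
suff : \sum_(0 <= n < m) (oneDsqr (n%:R : R))^-1 <= 4 * (1 - m.+1%:R^-1).
  have h0 : 0 <= m.+1%:R^-1 :> R by rewrite invr_ge0 ler0n.
  by move=> /le_trans; apply; move: (m.+1%:R^-1) h0 => u h0; lra.
elim: m => [|m IH]; first by rewrite big_geq // invr1 subrr mulr0.
rewrite big_nat_recr //=; apply: le_trans (lerD IH (h _ (ler0n _ m))) _.
have -> : m%:R + 1 = m.+1%:R :> R by rewrite natr1.
have -> : m%:R + 2 = m.+2%:R :> R by rewrite -(natrD R m 2) addn2.
by rewrite -mulrDr addrA subrK.
Qed.

Lemma peetre (n v a : R) : `|v| <= a ->
  (oneDsqr (n + v))^-1 <= 2 * (1 + a ^+ 2) * (oneDsqr n)^-1.
Proof.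
move=> va; have p (x : R) : 0 < oneDsqr x by rewrite (lt_le_trans ltr01) // oneDsqr_ge1.
rewrite ler_pdivlMr // ler_pdivrMl //.
have : v ^+ 2 <= a ^+ 2 by rewrite -real_normK ?num_real // lerXn2r ?nnegrE // (le_trans _ va).
rewrite /oneDsqr => h; have := sqr_ge0 (n + v); have := sqr_ge0 (n + v + v).
have := mulr_ge0 (sqr_ge0 a) (sqr_ge0 (n + v)); nra.
Qed.

Variables (f : R -> R) (A : R) (N : nat) (theta : R).
Hypotheses (nf : nice f A) (N_gt0 : (0 < N)%N).

Let hN : R := N%:R / 2.
Let a0 : R := `|theta| + 2^-1.
Let B : R := A * (2 * (1 + a0 ^+ 2)).

Lemma window_cst_ge0 : 0 <= B.
Proof. by rewrite /B mulr_ge0 ?(nice_ge0 nf) // mulr_ge0 // addr_ge0 // sqr_ge0. Qed.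

(** The point is N (z + v) with |v| at most |theta| + 1/2; Peetre's inequality moves the decay from
    z + v to z. The constant may depend on theta, because the limit over K is taken at fixed theta
    and yields an exact identity. *)
Lemma decay_window (g : R -> R) (z s : R) : decays g A -> `|s| <= hN ->
  `|g (N%:R * (theta + z) + s)| <= B * (oneDsqr z)^-1.
Proof.
move=> gA sh; have N0 : 0 < N%:R :> R by rewrite ltr0n.
have N1 : 1 <= N%:R :> R by rewrite ler1n.
apply: le_trans (gA _) _; rewrite /B -mulrA ler_wpM2l ?(nice_ge0 nf) //.
pose v := theta + s / N%:R.
have va : `|v| <= a0.
  apply: le_trans (ler_normD _ _) _; rewrite /a0 lerD2l normrM normfV (gtr0_norm N0).
  by rewrite ler_pdivrMr // mulrC.
apply: le_trans (peetre z va).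
have -> : N%:R * (theta + z) + s = N%:R * (z + v).
  by rewrite /v; field; rewrite gt_eqF.
have p (x : R) : 0 < oneDsqr x by rewrite (lt_le_trans ltr01) // oneDsqr_ge1.
rewrite lef_pV2 ?posrE // /oneDsqr lerD2l exprMn.
by rewrite -[leLHS]mul1r ler_wpM2r ?sqr_ge0 // expr_ge1 // ltW.
Qed.

Lemma lip_window (z s : R) : `|s| <= hN ->
  `|f (N%:R * (theta + z) + s) - f (N%:R * (theta + z))| <= B * (oneDsqr z)^-1 * `|s|.
Proof.
move=> sh; set c := N%:R * (theta + z).
have := @MVT_bound R f c (c + s) (B * (oneDsqr z)^-1) (nice_derivable nf).
have -> : c + s - c = s by rewrite addrAC subrr add0r.
apply=> x hx; rewrite -(subrK c x) addrC; apply: decay_window (nice_deriv nf) _.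
exact: le_trans hx sh.
Qed.

Let ker K (x : R) := f x * fejer K (x / N%:R - theta).
Let EK K : R := \int[mu]_(s in `[- hN, hN]) (`|s| * `|fejer K (s / N%:R)|).

Lemma continuous_ker K : continuous (ker K).
Proof.
move=> x; apply: cvgM; first exact: (nice_continuous nf).
apply: continuous_comp; last exact: continuous_fejer.
by apply: cvgB; [apply: cvgM; [exact: cvg_id|exact: cvg_cst]|exact: cvg_cst].
Qed.

Lemma continuous_absfejer K : continuous (fun s : R => `|s| * `|fejer K (s / N%:R)|).
Proof.
have cd : continuous (fun s : R => fejer K (s / N%:R)).
  by apply: continuous_divN; exact: continuous_fejer.
by move=> s; apply: cvgM; [exact: norm_continuous|apply: cvg_norm; exact: cd].
Qed.

Lemma EK_ge0 K : 0 <= EK K.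
Proof. by apply: Rintegral_ge0 => s _; rewrite mulr_ge0. Qed.

(** On the period around its centre the kernel acts as K N times a point mass; the error is the
    local Lipschitz constant of f times the first moment [EK K]. *)
Lemma ker_piece K (z : R) : (forall y, fejer K (y + z) = fejer K y) ->
  `|\int[mu]_(x in `[N%:R * (theta + z) - hN, N%:R * (theta + z) + hN]) ker K x
    - f (N%:R * (theta + z)) * (K%:R * N%:R)| <= B * (oneDsqr z)^-1 * EK K.
Proof.
move=> pz; set c := N%:R * (theta + z).
have N0 : N%:R != 0 :> R by rewrite pnatr_eq0 -lt0n.
have h0 : 0 < hN by rewrite /hN divr_gt0 ?ltr0n.
rewrite Rintegral_shift; last exact: continuous_ker; last by rewrite lerNl (le_trans _ (ltW h0)) // oppr_le0 ltW.
have E1 s : ker K (c + s) = f (c + s) * fejer K (s / N%:R).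
  rewrite /ker -(pz (s / N%:R)); congr (_ * fejer K _).
  by rewrite /c; field.
have cfe : continuous (fun s : R => fejer K (s / N%:R)) by apply: continuous_divN; exact: continuous_fejer.
have cfc : continuous (fun s : R => f (c + s)).
  move=> s; apply: continuous_comp; last exact: (nice_continuous nf).
  by apply: cvgD; [exact: cvg_cst|exact: cvg_id].
have cm (g : R -> R) : continuous g -> continuous (fun s : R => g s * fejer K (s / N%:R)).
  by move=> cg s; apply: cvgM; [exact: cg|exact: cfe].
rewrite -(Rintegral_fejer R N_gt0 K) -/hN -RintegralZl //; last exact: integrable_itv.
under [X in `|X - _|]eq_Rintegral => s _ do rewrite E1.
rewrite -RintegralB //; last 2 first.
- by apply: integrable_itv; exact: cm.
- by apply: integrable_itv; apply: (cm (fun=> f c)) => s; exact: cvg_cst.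
have cd : continuous (fun s : R => f (c + s) * fejer K (s / N%:R) - f c * fejer K (s / N%:R)).
  by move=> s; apply: cvgB; apply: cm => // u; exact: cvg_cst.
apply: le_trans (le_normr_Rintegral _ _) _ => //; first exact: integrable_itv.
rewrite /EK -RintegralZl //; last exact/integrable_itv/continuous_absfejer.
apply: le_Rintegral => //.
- by apply: integrable_itv => s; apply: cvg_norm; exact: cd.
- by apply: integrable_itv => s; apply: cvgM; [exact: cvg_cst|exact: continuous_absfejer].
move=> s; rewrite /= in_itv /= => hs; rewrite -mulrBl normrM mulrA ler_wpM2r //.
by apply: lip_window; rewrite ler_norml.
Qed.

Let pt (z : R) := f (N%:R * (theta + z)).
Let wpart m := \sum_(0 <= n < m) pt n%:R + \sum_(0 <= n < m) pt (- n.+1%:R).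
(** 2m whole periods, centred at N (theta + n) for -m <= n < m, one for each term of [wpart m]. *)
Let window m : set R := `[N%:R * (theta - m%:R) - hN, N%:R * (theta + m%:R) - hN].

Lemma window_split K m : \int[mu]_(x in window m) ker K x =
  \sum_(0 <= n < m) (\int[mu]_(x in `[N%:R * (theta + n%:R) - hN, N%:R * (theta + n%:R) + hN]) ker K x)
  + \sum_(0 <= n < m) (\int[mu]_(x in `[N%:R * (theta + - n.+1%:R) - hN, N%:R * (theta + - n.+1%:R) + hN]) ker K x).
Proof.
have N0 : 0 < N%:R :> R by rewrite ltr0n.
have ck := @continuous_ker K.
elim: m => [|m IH].
  by rewrite !big_geq // addr0 /window subr0 addr0 set_itv1 Rintegral_set1.
rewrite !big_nat_recr //= addrACA -IH /window.
set a := N%:R * (theta - m%:R) - hN; set b := N%:R * (theta + m%:R) - hN.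
have -> : N%:R * (theta + m.+1%:R) - hN = N%:R * (theta + m%:R) + hN.
  by rewrite /hN -natr1; field.
have e2 : N%:R * (theta + - m.+1%:R) + hN = a by rewrite /a /hN -natr1; field.
rewrite e2 -/b.
have ab : a <= b by rewrite /a /b lerD2r ler_pM2l // lerD2l; have := ler0n R m; lra.
have h1 : N%:R * (theta - m.+1%:R) - hN <= a.
  by rewrite /a lerD2r ler_pM2l // -natr1; lra.
have h2 : b <= N%:R * (theta + m%:R) + hN by rewrite /b /hN; have := ltW N0; lra.
rewrite (Rintegral_split ck h1 (le_trans ab h2)) (Rintegral_split ck ab h2).
by rewrite [LHS]addrC -[LHS]addrA.
Qed.

(** The bound is independent of m, so the window can exhaust the line at fixed K; 8 is 4 for each of
    the two half series. *)
Lemma window_bound K m :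
  `|\int[mu]_(x in window m) ker K x - wpart m * (K%:R * N%:R)| <= B * 8 * EK K.
Proof.
rewrite window_split /wpart mulrDl !mulr_suml opprD addrACA -!sumrB.
have -> : B * 8 * EK K = 4 * (B * EK K) + 4 * (B * EK K) by ring.
have BE : 0 <= B * EK K by rewrite mulr_ge0 ?window_cst_ge0 ?EK_ge0.
apply: le_trans (ler_normD _ _) _; apply: lerD.
  apply: le_trans (ler_norm_sum _ _ _) _.
  apply: le_trans (_ : \sum_(0 <= n < m) (oneDsqr (n%:R : R))^-1 * (B * EK K) <= _).
    apply: ler_sum => n _; rewrite [leRHS]mulrA [_ * B]mulrC; apply: ker_piece => y.
    exact: fejerD.
  by rewrite -mulr_suml ler_wpM2r // sum_oneDsqrV_le4.
apply: le_trans (ler_norm_sum _ _ _) _.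
apply: le_trans (_ : \sum_(0 <= n < m) (oneDsqr (n%:R : R))^-1 * (B * EK K) <= _).
  apply: ler_sum => n _; apply: le_trans (ker_piece _) _.
    by move=> y; exact: fejerB.
  rewrite [leRHS]mulrA [_ * B]mulrC ler_wpM2r ?EK_ge0 // ler_wpM2l ?window_cst_ge0 //.
  have p (x : R) : 0 < oneDsqr x by rewrite (lt_le_trans ltr01) // oneDsqr_ge1.
  rewrite lef_pV2 ?posrE // /oneDsqr lerD2l sqrrN lerXn2r ?nnegrE ?ler0n // ler_nat //.
by rewrite -mulr_suml ler_wpM2r // sum_oneDsqrV_le4.
Qed.

Lemma cvg_window (h : R -> R) C : continuous h -> decays h C ->
  (fun m => \int[mu]_(x in window m) h x) @ \oo --> \int[mu]_(x in setT) h x.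
Proof.
move=> ch hC; have N0 : 0 < N%:R :> R by rewrite ltr0n.
under eq_fun do rewrite Rintegral_mkcond.
apply: (@cvg_Rintegral _ _ _ _ (fun x => `|h x|)) => //.
- move=> m; apply: (measurable_restrictT _ _).1; first exact: measurable_itv.
  by apply: measurable_funTS; exact: continuous_measurable_fun.
- move=> x _; apply: cvg_near_cst; near=> m.
  rewrite patchE mem_set // /window /= in_itv /=.
  have hm : (`|x - N%:R * theta| + hN) / N%:R <= m%:R by near: m; exact: nbhs_infty_ger.
  have {}hm : `|x - N%:R * theta| + hN <= N%:R * m%:R by rewrite [leRHS]mulrC -ler_pdivrMr.
  have h0 : 0 < hN by rewrite /hN divr_gt0.
  have : `|x - N%:R * theta| <= N%:R * m%:R - hN by lra.
  by rewrite ler_norml mulrBr mulrDr => /andP[h1 h2]; apply/andP; split; lra.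
- exact: integrable_norm (integrable_decays ch hC).
- by move=> m x _; rewrite patchE; case: ifP => // _; rewrite normr0.
Unshelve. all: by end_near. Qed.

Lemma cvg_series_decay (g : nat -> R) C : (forall n, `|g n| <= C * (oneDsqr (n%:R : R))^-1) ->
  cvgn (series g).
Proof.
move=> hg; apply: normed_cvg.
have C0 : 0 <= C by have := le_trans (normr_ge0 _) (hg 0%N); rewrite /oneDsqr expr0n addr0 invr1 mulr1.
have -> : [normed series g] = (fun m => \sum_(0 <= n < m) `|g n|) by [].
apply: nondecreasing_is_cvgn.
  by apply/nondecreasing_seqP => n; rewrite big_nat_recr //= lerDl.
exists (C * 4) => _ [m _ <-].
apply: le_trans (_ : \sum_(0 <= n < m) C * (oneDsqr (n%:R : R))^-1 <= _).
  by apply: ler_sum => n _; exact: hg.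
by rewrite -mulr_sumr ler_wpM2l // sum_oneDsqrV_le4.
Qed.

Lemma cvg_wpart : wpart @ \oo --> sumZ (fun n : int => f (N%:R * (theta + n%:~R))).
Proof.
rewrite /sumZ; have h0 : `|0 : R| <= hN by rewrite normr0 /hN divr_ge0 ?ler0n.
have e (z : R) : `|pt z| <= B * (oneDsqr z)^-1.
  by rewrite /pt -[X in f X]addr0; apply: decay_window (nice_decays nf) h0.
have -> : wpart = (fun m => series (fun n : nat => f (N%:R * (theta + (n%:Z)%:~R))) m
     + series (fun n : nat => f (N%:R * (theta + (- (n.+1)%:Z)%:~R))) m).
  by apply/funext => m; rewrite /wpart /series /pt /=; congr (_ + _).
apply: cvgD; apply: (@cvg_series_decay _ B) => n; first exact: e.
rewrite mulrNz; apply: le_trans (e _) _; rewrite ler_wpM2l ?window_cst_ge0 //.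
have p (x : R) : 0 < oneDsqr x by rewrite (lt_le_trans ltr01) // oneDsqr_ge1.
by rewrite lef_pV2 ?posrE // /oneDsqr lerD2l sqrrN lerXn2r ?nnegrE ?ler0n // ler_nat.
Qed.

Definition poisson_term (k : nat) : R :=
  cosint f (k%:R / N%:R) * cos (k%:R * (2 * pi * theta)) +
  sinint f (k%:R / N%:R) * sin (k%:R * (2 * pi * theta)).

Definition poisson_sum (j : nat) : R := cosint f 0 + 2 * \sum_(1 <= k < j.+1) poisson_term k.

Lemma integral_dirichlet j :
  \int[mu]_(x in setT) (f x * dirichlet j (x / N%:R - theta)) = poisson_sum j.
Proof.
have N0 : N%:R != 0 :> R by rewrite pnatr_eq0 -lt0n.
pose tm k (x : R) := f x * cos (2 * pi * (k%:R / N%:R) * x) * cos (k%:R * (2 * pi * theta)) +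
   f x * sin (2 * pi * (k%:R / N%:R) * x) * sin (k%:R * (2 * pi * theta)).
have ic k := integrable_mulcos (2 * pi * (k%:R / N%:R)) nf.
have is_ k := integrable_mulsin (2 * pi * (k%:R / N%:R)) nf.
have iZ (g : R -> R) (r : R) : mu.-integrable setT (EFin \o g) -> mu.-integrable setT (EFin \o (fun x => g x * r)).
  move=> ig; have := @integrableZl _ _ _ mu _ measurableT r _ ig.
  by apply: eq_integrable => // x _; rewrite /= mulrC EFinM.
have it k : mu.-integrable setT (EFin \o tm k).
  exact: (integrableD measurableT (iZ _ _ (ic k)) (iZ _ _ (is_ k))).
have i0 : mu.-integrable setT (EFin \o (fun x => f x * cos (2 * pi * 0 * x))).
  exact: (integrable_mulcos _ nf).
have E x : f x * dirichlet j (x / N%:R - theta)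
    = f x * cos (2 * pi * 0 * x) + (\sum_(1 <= k < j.+1) tm k x) * 2.
  rewrite /dirichlet mulrDr mulr1 mulr0 mul0r cos0 mulr1; congr (_ + _).
  rewrite mulrCA mulrC; congr (_ * _); rewrite mulr_sumr; apply: eq_bigr => k _.
  have -> : k%:R * (2 * pi * (x / N%:R - theta)) = 2 * pi * (k%:R / N%:R) * x - k%:R * (2 * pi * theta).
    by field.
  by rewrite cosB /tm; ring.
under eq_Rintegral => x _ do rewrite E.
have iS : mu.-integrable setT (EFin \o (fun x => \sum_(1 <= k < j.+1) tm k x)).
  exact: integrable_sumR.
rewrite RintegralD //; last exact: iZ.
rewrite RintegralZr // Rintegral_sum // [_ * 2]mulrC /poisson_sum; congr (_ + _ * _).
apply: eq_bigr => k _; rewrite /tm RintegralD //; try exact: iZ.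
by rewrite !RintegralZr.
Qed.

Lemma integral_ker K : \int[mu]_(x in setT) ker K x = \sum_(0 <= j < K) poisson_sum j.
Proof.
have E x : ker K x = \sum_(0 <= j < K) f x * dirichlet j (x / N%:R - theta).
  by rewrite /ker /fejer mulr_sumr.
under eq_Rintegral => x _ do rewrite E.
rewrite Rintegral_sum //; last first.
  move=> j; apply: (integrable_mul nf (B := 1 + 2 * j%:R)) => [x|x]; last exact: dirichlet_max.
  apply: (@continuous_comp _ _ _ (fun u : R => u / N%:R - theta) (@dirichlet R j));
    last exact: continuous_dirichlet.
  by apply: cvgB; [apply: cvgM; [exact: cvg_id|exact: cvg_cst]|exact: cvg_cst].
by apply: eq_bigr => j _; rewrite integral_dirichlet.
Qed.

Lemma fejer_max K (y : R) : `|fejer K y| <= \sum_(0 <= j < K) (1 + 2 * j%:R).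
Proof.
by apply: le_trans (ler_norm_sum _ _ _) _; apply: ler_sum => j _; exact: dirichlet_max.
Qed.

Hypothesis f_bandlimited : forall k : nat, (N <= k)%N ->
  cosint f (k%:R / N%:R) = 0 /\ sinint f (k%:R / N%:R) = 0.

(* Being constant from N on, the partial sums of the Fourier side equal their Cesaro limit. *)
Lemma poisson_sum_stable j : (N <= j)%N -> poisson_sum j = poisson_sum N.
Proof.
move=> Nj; rewrite /poisson_sum (@big_cat_nat _ _ _ N.+1 1 j.+1) //=.
rewrite [X in _ + 2 * (_ + X)]big_nat_cond [X in _ + 2 * (_ + X)]big1 ?addr0 //.
move=> k /andP[/andP[Nk _] _]; have [c0 s0] := f_bandlimited (ltnW Nk).
by rewrite /poisson_term c0 s0 !mul0r addr0.
Qed.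

(** Dividing the window estimate by K, the Fourier side becomes T + c0/K and the error becomes a
    multiple of the first moment relative to K; both corrections vanish as K grows. *)
Lemma poisson_summation :
  N%:R * sumZ (fun n : int => f (N%:R * (theta + n%:~R))) = poisson_sum N.
Proof.
set S := sumZ _; set T := poisson_sum N.
have key K : `|\sum_(0 <= j < K) poisson_sum j - S * (K%:R * N%:R)| <= B * 8 * EK K.
  rewrite -integral_ker.
  apply: (@cvg_le_lim (fun m => `|\int[mu]_(x in window m) ker K x - wpart m * (K%:R * N%:R)|));
    last by move=> m; exact: window_bound.
  apply: cvg_norm; apply: cvgB.
    apply: cvg_window; first exact: continuous_ker.
    by apply: decays_mul (nice_decays nf) _ => x; exact: fejer_max.
  by apply: cvgM; [exact: cvg_wpart|exact: cvg_cst].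
(* [c0] collects the finitely many partial sums preceding stability. *)
pose c0 := \sum_(0 <= j < N) (poisson_sum j - T).
have sumE K : (N <= K)%N -> \sum_(0 <= j < K) poisson_sum j = K%:R * T + c0.
  move=> NK; have -> : \sum_(0 <= j < K) poisson_sum j = \sum_(0 <= j < K) (poisson_sum j - T) + K%:R * T.
    by rewrite sumrB sumr_const_nat subn0 -[T *+ K]mulr_natl subrK.
  rewrite addrC; congr (_ + _); rewrite (@big_cat_nat _ _ _ N 0 K) //=.
  rewrite [X in _ + X]big_nat_cond [X in _ + X]big1 ?addr0 //.
  by move=> k /andP[/andP[Nk _] _]; rewrite poisson_sum_stable // subrr.
apply/eqP; rewrite eq_sym -subr_eq0 -normr_le0.
pose v K := `|c0| * K%:R^-1 + B * 8 * \int[mu]_(s in `[- hN, hN]) (`|s| * `|fejer K (s / N%:R)| / K%:R).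
apply: (@cvg_ge_lim v _ _ (maxn N 1)).
  rewrite -[X in _ --> X]addr0 -[in X in X + _](mulr0 `|c0|) -[in X in _ + X](mulr0 (B * 8)).
  apply: cvgD; apply: cvgM; try exact: cvg_cst.
    rewrite -(cvg_shiftS (fun K => _)) /=; apply: (@cvg_natSinv_bound _ _ _ 1) => K.
    by rewrite subr0 ger0_norm ?invr_ge0 ?ler0n // mul1r.
  exact: fejer_moment_cvg.
move=> K; rewrite geq_max => /andP[NK K1].
have K0 : 0 < K%:R :> R by rewrite ltr0n.
rewrite /v RintegralZr //; last exact/integrable_itv/continuous_absfejer.
rewrite -/(EK K) mulrA -mulrDl ler_pdivlMr //.
have := key K; rewrite (sumE K NK) => h.
have -> : `|T - N%:R * S| * K%:R = `|K%:R * T - S * (K%:R * N%:R)|.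
  by rewrite -[X in _ * X](gtr0_norm K0) -normrM; congr (`|_|); ring.
have -> : K%:R * T - S * (K%:R * N%:R) = (K%:R * T + c0 - S * (K%:R * N%:R)) - c0 by ring.
apply: le_trans (ler_normB _ _) _; lra.
Qed.

End PoissonSummation.

(** * Error bounds uniform in q *)

Section ErrorBounds.
Variable R : realType.

(* Any v < 1 with 1/sqrt 3 <= v^3 would do; q >= 3 since p is odd. *)
Let v : R := 9 / 10.

Lemma nine_tenths_ge0 : 0 <= v. Proof. by rewrite /v; lra. Qed.
Lemma nine_tenths_le1 : v <= 1. Proof. by rewrite /v; lra. Qed.

(** 110 = 90 + 20 is the value of the full series: v/(1-v)^2 = 90 and 2/(1-v) = 20. *)
Lemma sum_linear_geom n : \sum_(0 <= r < n) (r%:R + 2) * v ^+ r <= 110.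
Proof.
suff -> : \sum_(0 <= r < n) (r%:R + 2) * v ^+ r = 110 - (10 * n%:R + 110) * v ^+ n.
  by rewrite gerBl mulr_ge0 ?exprn_ge0 ?nine_tenths_ge0 // addr_ge0 // mulr_ge0 // ler0n.
elim: n => [|n IH]; first by rewrite big_geq // mulr0 add0r expr0 mulr1 subrr.
by rewrite big_nat_recr //= IH exprS -natr1 /v; field.
Qed.

(* The growth r v^(m - r) of the error at the edge r = m is compensated by the
   linear vanishing of C there, and C r contributes 1/N at the single index r = m + 1. *)
Lemma weighted_sum_bound (N m : nat) (C z : nat -> R) (Bc L : R) : (0 < N)%N -> (m <= N)%N ->
  0 <= Bc -> 0 <= L ->
  (forall r, (0 < r <= m)%N -> `|C r| <= Bc) ->
  (forall r, (0 < r <= m)%N -> `|C r| <= L * ((m - r)%N%:R + 2) / N%:R) ->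
  `|C m.+1| <= L / N%:R ->
  (forall r, (m.+1 < r)%N -> C r = 0) ->
  (forall r, (0 < r <= m)%N -> `|z r| <= (r%:R + 2) * v ^+ r + r%:R * v ^+ (m - r)) ->
  (forall r, `|z r| <= N%:R + 1) ->
  `|\sum_(1 <= r < N.+1) C r * z r| <= (Bc + L) * 110 + 2 * L.
Proof.
move=> N0 mN Bc0 L0 hB hL hL1 hC hz hT.
have NR : 0 < N%:R :> R by rewrite ltr0n.
have N1 : 1 <= N%:R :> R by rewrite ler1n.
rewrite (@big_cat_nat _ _ _ m.+1) //=; apply: le_trans (ler_normD _ _) _; apply: lerD; last first.
  have [->|mN'] := eqVneq m N; first by rewrite big_geq // normr0 mulr_ge0.
  rewrite big_ltn; last by lia.
  rewrite [X in _ + X]big_nat_cond [X in _ + X]big1 ?addr0 => [|r /andP[/andP[mr _] _]]; last first.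
    by rewrite hC // mul0r.
  rewrite normrM; apply: le_trans (ler_pM _ _ hL1 (hT _)) _ => //.
  rewrite mulrAC ler_pdivrMr //; nra.
apply: le_trans (ler_norm_sum _ _ _) _.
apply: le_trans (_ : \sum_(1 <= r < m.+1) (Bc * ((r%:R + 2) * v ^+ r)
     + L * (((m - r)%N%:R + 2) * v ^+ (m - r))) <= _).
  rewrite big_nat_cond [leRHS]big_nat_cond; apply: ler_sum => r /andP[/andP[r1 rm] _].
  have rr : (0 < r <= m)%N by rewrite r1 -ltnS.
  rewrite normrM; apply: le_trans (ler_wpM2l (normr_ge0 _) (hz _ rr)) _.
  have vr k : 0 <= v ^+ k by rewrite exprn_ge0 ?nine_tenths_ge0.
  rewrite mulrDr; apply: lerD.
    by apply: ler_wpM2r (hB _ rr); rewrite mulr_ge0 ?vr // addr_ge0 ?ler0n.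
  rewrite mulrA mulrA; apply: ler_wpM2r => //.
  apply: le_trans (ler_wpM2r (ler0n _ r) (hL _ rr)) _.
  rewrite mulrAC ler_pdivrMr // ler_wpM2l //.
    by rewrite mulr_ge0 // addr_ge0 ?ler0n.
  by rewrite ler_nat; lia.
rewrite big_split /= -!mulr_sumr mulrDl; apply: lerD; apply: ler_wpM2l => //.
  apply: le_trans (sum_linear_geom m.+1); rewrite [leRHS]big_ltn //= expr0 lerDr.
  by rewrite mulr1 addr_ge0 ?ler0n.
apply: le_trans (sum_linear_geom m); rewrite big_nat_rev /= big_add1 /=.
rewrite big_nat_cond [leRHS]big_nat_cond; apply: ler_sum => r /andP[/andP[_ rm] _].
by rewrite (_ : (m - (1 + m.+1 - r.+2))%N = r) //; lia.
Qed.

(** The terms before the last have exponents at most r/3: relative to q^(r/2) they cost (r + 2)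
    q^(-r/6), and 1/sqrt q <= 3/5 <= v^3 turns this into v^r. For odd d the last term is r times
    sqrt q to the power -(d - 1 - 2e - r) = -(m - r). *)
Lemma bad_count_bound (q r d e m : nat) : (3 <= q)%N -> (0 < r)%N -> odd d ->
  d.-1 = (m + 2 * e)%N -> (r <= m)%N ->
  (1 + \sum_(1 <= k < (r %/ 3).+1) q ^ k + q ^ (r %/ 4)
     + (if (2 * r < d)%N then 0 else q ^ e * (q ^ (r - d./2) * r)))%N%:R / Num.sqrt (q%:R : R) ^+ r
  <= (r%:R + 2) * v ^+ r + r%:R * v ^+ (m - r).
Proof.
move=> q3 r0 od dm rm; set sq := Num.sqrt _.
have q0 : 0 < q%:R :> R by rewrite ltr0n; lia.
have sq0 : 0 < sq by rewrite sqrtr_gt0.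
have sq2 : sq ^+ 2 = q%:R by rewrite sqr_sqrtr // ltW.
(* 5/3 lies below sqrt 3, as 25/9 < 3. *)
have sq53 : 5 / 3 <= sq.
  rewrite leNgt; apply/negP => h.
  have q3R : 3 <= q%:R :> R by rewrite (ler_nat R 3 q).
  have : sq ^+ 2 < 3 by rewrite expr2; nra.
  by rewrite sq2 ltNge q3R.
have y35 : sq^-1 <= 3 / 5 by rewrite -[3 / 5]invrK lef_pV2 ?posrE ?invr_gt0; lra.
have y0 : 0 <= sq^-1 by rewrite invr_ge0 ltW.
have P1 k : (2 * k <= r)%N -> (q ^ k)%:R / sq ^+ r = sq^-1 ^+ (r - 2 * k).
  move=> kr; rewrite natrX -sq2 -exprM -[in X in _ / X](subnKC kr) exprD.
  by rewrite exprVn; field; rewrite !expf_neq0 // gt_eqF.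
rewrite natrD mulrDl; apply: lerD.
  apply: le_trans (_ : ((r + 2) * q ^ (r %/ 3))%:R / sq ^+ r <= _).
    rewrite ler_pM2r ?invr_gt0 ?exprn_gt0 // ler_nat.
    have qk k : (k <= r %/ 3)%N -> (q ^ k <= q ^ (r %/ 3))%N by move=> h; apply: leq_pexp2l; lia.
    have s1 : (\sum_(1 <= k < (r %/ 3).+1) q ^ k <= (r %/ 3) * q ^ (r %/ 3))%N.
      apply: leq_trans (_ : \sum_(1 <= k < (r %/ 3).+1) q ^ (r %/ 3) <= _)%N.
        rewrite big_nat_cond [X in (_ <= X)%N]big_nat_cond; apply: leq_sum => k /andP[/andP[_ kr] _].
        exact: qk.
      by rewrite sum_nat_const_nat subn1.
    have s2 : (q ^ (r %/ 4) <= q ^ (r %/ 3))%N by apply: qk; lia.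
    have s3 : (1 <= q ^ (r %/ 3))%N by rewrite expn_gt0; lia.
    have : (r %/ 3 <= r)%N by lia.
    nia.
  rewrite natrM -mulrA P1; last by lia.
  rewrite natrD ler_wpM2l ?addr_ge0 ?ler0n //.
  apply: le_trans (_ : (v ^+ 3) ^+ (r - 2 * (r %/ 3)) <= _).
    apply: lerXn2r; rewrite ?nnegrE // ?exprn_ge0 ?nine_tenths_ge0 //.
    by apply: le_trans y35 _; rewrite /v !exprS expr0; lra.
  by rewrite -exprM; apply: ler_wiXn2l; [exact: nine_tenths_ge0|exact: nine_tenths_le1|lia].
case: ifPn => [_|]; first by rewrite mul0r mulr_ge0 ?ler0n ?exprn_ge0 ?nine_tenths_ge0.
rewrite -leqNgt => dr; rewrite mulnA -expnD natrM mulrAC mulrC P1; last by lia.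
rewrite ler_wpM2l ?ler0n // (_ : (r - 2 * (e + (r - d./2)))%N = (m - r)%N); last by lia.
by apply: lerXn2r; rewrite ?nnegrE ?nine_tenths_ge0 //; apply: le_trans y35 _; rewrite /v; lra.
Qed.

End ErrorBounds.

(** Division by p injects the odd multiples of p below d into the odd numbers up to (d-1)/p. The + 2
    absorbs the roundings and reappears at the edge of the support. *)
Lemma odd_mult_bound p d : (0 < p)%N -> (2 * odd_mult p d <= d.-1 %/ p + 2)%N.
Proof.
move=> p0; set k := (d.-1 %/ p)%N; set m := (k.+2)./2.
have km : (k < 2 * m)%N by rewrite /m; lia.
suff : (odd_mult p d <= m)%N by rewrite /m; lia.
have lt (i : 'I_d) : (i %/ p < 2 * m)%N.
  apply: leq_ltn_trans km; rewrite /k leq_div2r //; have := ltn_ord i; lia.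
pose A := finset (fun i : 'I_d => odd i && (p %| i)%N).
pose g (i : 'I_d) := Ordinal (lt i).
have gi : {in A &, injective g}.
  move=> i j; rewrite !inE => /andP[_ pi] /andP[_ pj] /(congr1 val) /= e.
  by apply: val_inj; rewrite /= -(divnK pi) -(divnK pj) e.
rewrite /odd_mult -cardsE -(card_in_imset gi).
have := card_odd_ge m 0; rewrite subn0 => hm; apply: leq_trans hm.
apply: subset_leq_card; apply/fintype.subsetP => _ /imsetP[i iA ->].
move: iA; rewrite !inE /= => /andP[oi pi]; rewrite andbT.
by move: oi; rewrite -{1}(divnK pi) oddM => /andP[].
Qed.

(** * Real and imaginary parts *)

Section ComplexParts.
Variable R : realType.
Local Open Scope complex_scope.

Lemma expiX (t : R) r : expi t ^+ r = expi (r%:R * t).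
Proof.
elim: r => [|r IH]; first by rewrite expr0 /expi mul0r mulr0 cos0 sin0.
have e : 2 * pi * (r.+1%:R * t) = 2 * pi * t + 2 * pi * (r%:R * t) by rewrite -natr1; ring.
rewrite exprS IH /expi e.
by rewrite cosD sinD; apply/eqP; rewrite eq_complex /= addrC eqxx /= addrC.
Qed.

Lemma Re_sum (I : Type) (s : seq I) (P : pred I) (F : I -> R[i]) :
  complex.Re (\sum_(i <- s | P i) F i) = \sum_(i <- s | P i) complex.Re (F i).
Proof. exact: (raddf_sum (@complex.Re R : Rcomplex R -> R)). Qed.

Lemma Im_sum (I : Type) (s : seq I) (P : pred I) (F : I -> R[i]) :
  complex.Im (\sum_(i <- s | P i) F i) = \sum_(i <- s | P i) complex.Im (F i).
Proof. exact: (raddf_sum (@complex.Im R : Rcomplex R -> R)). Qed.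

Lemma norm_Re_le (z : R[i]) (b : R) : `|z| <= b%:C -> `|complex.Re z| <= b.
Proof. by move=> h; rewrite -lecR; apply: le_trans h; exact: normc_ge_Re. Qed.

Lemma norm_Im_le (z : R[i]) (b : R) : `|z| <= b%:C -> `|complex.Im z| <= b.
Proof.
rewrite normc_def lecR; apply: le_trans.
by rewrite -sqrtr_sqr ler_wsqrtr // lerDr sqr_ge0.
Qed.

Lemma norm_complex_le (a b e : R) : `|a| + `|b| < e -> `|a +i* b| < e%:C.
Proof.
rewrite normc_def ltcR /=; apply: le_lt_trans.
have h : 0 <= `|a| + `|b| by rewrite addr_ge0.
rewrite -[leRHS](ger0_norm h) -sqrtr_sqr ler_wsqrtr //.
rewrite sqrrD !real_normK ?num_real // -addrA [_ *+ 2 + _]addrC addrA lerDl.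
by rewrite mulrn_wge0 // mulr_ge0.
Qed.

End ComplexParts.

(** * Averaged power sums of the angles *)

Section MomentBound.
Variables (R : realType) (p : nat) (psi : 'F_p -> R[i]).
Hypotheses (p_prime : prime p) (p_gt2 : (2 < p)%N).
Hypothesis psi_add : forall a b : 'F_p, psi (a + b) = psi a * psi b.
Hypothesis psi_neq0 : forall a : 'F_p, psi a != 0.
Hypothesis psi_nontriv : exists a : 'F_p, psi a != 1.
Variables (F E : finFieldType) (iota : {rmorphism F -> E}) (n r d : nat).
Hypotheses (pE : p \in [pchar E]) (n_gt0 : (0 < n)%N) (cF : #|F| = (p ^ n)%N).
Hypotheses (r_gt0 : (0 < r)%N) (cE : #|E| = ((p ^ n) ^ r)%N) (d_odd : odd d).
Hypothesis p_ndvd_d : ~~ (p %| d)%N.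
Variable theta : {ffun 'I_d.+1 -> F} -> 'I_d.-1 -> R.
Let sq : R := Num.sqrt #|F|%:R.
Let S := AS0odd p F d.
Hypothesis theta_spec : forall c, c \in S -> char_sum iota psi (ASpoly c) =
  - \sum_(i < d.-1) ((real_complex R sq) * expi (theta c i)) ^+ r.

Let Z : R[i] := \sum_(c in S) \sum_(i < d.-1) expi (r%:R * theta c i).
Let delta : R := if odd r then 0 else 1.

Lemma norm_real_complex (x : R) : `|real_complex R x| = real_complex R `|x|.
Proof. by rewrite normc_def /= expr0n /= addr0 sqrtr_sqr. Qed.

(** The minus sign between character sums and power sums turns the main term q^(r/2) into -1 on
    average for even r, hence the plus sign before [delta]. *)
Lemma norm_moment : `|Z + real_complex R (#|S|%:R * delta)|
  <= real_complex R (#|S|%:R * (#|bad_set E p n r d|%:R / sq ^+ r)).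
Proof.
have q0 : 0 < #|F|%:R :> R by rewrite ltr0n; apply/card_gt0P; exists 0.
have sq0 : 0 < sq by rewrite sqrtr_gt0.
have sqr0 : 0 < sq ^+ r by rewrite exprn_gt0.
have := norm_sum_tchar p_prime p_gt2 psi_add psi_neq0 psi_nontriv iota pE n_gt0 cF r_gt0 cE d_odd p_ndvd_d.
have -> : \sum_(c in AS0odd p F d) \sum_x tchar psi (map_poly iota (ASpoly c)).[x]
    = - (real_complex R (sq ^+ r) * Z).
  rewrite /Z mulr_sumr -sumrN; apply: eq_bigr => c cS.
  rewrite -[LHS]/(char_sum iota psi (ASpoly c)) theta_spec //; congr (- _).
  rewrite mulr_sumr; apply: eq_bigr => i _.
  by rewrite exprMn expiX rmorphXn.
have -> : #|AS0odd p F d|%:R * (if odd r then 0 else ((p ^ n) ^ r./2)%:R)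
    = real_complex R (sq ^+ r) * real_complex R (#|S|%:R * delta).
  rewrite -rmorphM /= mulrCA rmorphM /= rmorph_nat; congr (_ * _).
  rewrite /delta; case: ifPn => [_|er]; first by rewrite mulr0 rmorph0.
  rewrite mulr1 -(rmorph_nat (real_complex R)) /=; congr (real_complex R _).
  rewrite natrX -cF -[in RHS](odd_double_half r) (negPf er) add0n -mul2n exprM.
  by rewrite sqr_sqrtr // ltW.
rewrite -opprD normrN -mulrDr normrM norm_real_complex (gtr0_norm sqr0).
rewrite -!(rmorph_nat (real_complex R)) -rmorphM normc_def -rmorphM !lecR.
have -> z : Num.sqrt (complex.Re z ^+ 2 + complex.Im z ^+ 2) = Normc.normc z :> R by case: z.
by move=> h; rewrite mulrA ler_pdivlMr // [leLHS]mulrC.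
Qed.

Lemma moment_bound (b : R) : #|bad_set E p n r d|%:R / sq ^+ r <= b ->
  `|\sum_(c in S) \sum_(i < d.-1) cos (r%:R * (2 * pi * theta c i)) + #|S|%:R * delta|
     <= #|S|%:R * b /\
  `|\sum_(c in S) \sum_(i < d.-1) sin (r%:R * (2 * pi * theta c i))| <= #|S|%:R * b.
Proof.
move=> hb; have {}hb : `|Z + real_complex R (#|S|%:R * delta)| <= real_complex R (#|S|%:R * b).
  by apply: le_trans norm_moment _; rewrite lecR ler_wpM2l ?ler0n.
have e t : r%:R * (2 * pi * t) = 2 * pi * (r%:R * t) :> R by ring.
have := norm_Im_le hb; have := norm_Re_le hb.
rewrite !raddfD /= addr0 Re_sum Im_sum => h1 h2; split.
  apply: le_trans h1; rewrite le_eqVlt; apply/orP; left; apply/eqP; congr (`|_ + _|).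
  by apply: eq_bigr => c _; rewrite Re_sum; apply: eq_bigr => i _; rewrite /= e.
apply: le_trans h2; rewrite le_eqVlt; apply/orP; left; apply/eqP; congr (`|_|).
by apply: eq_bigr => c _; rewrite Im_sum; apply: eq_bigr => i _; rewrite /= e.
Qed.

End MomentBound.

(** * The limit for a real test function *)

Section AnalyticCore.
Variables (R : realType) (p : nat).
Hypotheses (p_prime : prime p) (p_gt2 : (2 < p)%N).
Variables (f : R -> R) (A : R).
Hypothesis nf : nice f A.
Hypothesis f_supp : forall tau : R, 1 - p%:R^-1 <= `|tau| -> cosint f tau = 0 /\ sinint f tau = 0.
Local Notation mu := (@lebesgue_measure R).

Let Bc : R := A * int_oneDsqrV R.
Let L : R := 2 * pi * Bc.

Lemma decay_cst_ge0 : 0 <= Bc.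
Proof.
rewrite mulr_ge0 ?(nice_ge0 nf) //; apply: Rintegral_ge0 => x _.
by rewrite invr_ge0 (le_trans ler01) // oneDsqr_ge1.
Qed.

Lemma lipschitz_cst_ge0 : 0 <= L.
Proof. by rewrite /L mulr_ge0 ?decay_cst_ge0 // mulr_ge0 ?pi_ge0. Qed.

Lemma near_edge_bound (N r : nat) (b : R) : (0 < N)%N -> 0 <= b ->
  N%:R * (1 - p%:R^-1) - r%:R <= b ->
  `|cosint f (r%:R / N%:R)| <= L * b / N%:R /\ `|sinint f (r%:R / N%:R)| <= L * b / N%:R.
Proof.
move=> N0 b0; set t0 := 1 - p%:R^-1 => hb.
have NR : 0 < N%:R :> R by rewrite ltr0n.
have p1 : p%:R^-1 <= 1 :> R by rewrite invf_le1 ?ler1n ?ltr0n prime_gt0.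
have t00 : 0 <= t0 by rewrite subr_ge0.
have rN0 : 0 <= r%:R / N%:R :> R by rewrite divr_ge0 ?ler0n.
have Lb : 0 <= L * b / N%:R by rewrite divr_ge0 ?ler0n // mulr_ge0 ?lipschitz_cst_ge0.
have [ht|ht] := leP t0 (r%:R / N%:R).
  have [-> ->] : cosint f (r%:R / N%:R) = 0 /\ sinint f (r%:R / N%:R) = 0.
    by apply: f_supp; rewrite ger0_norm.
  by rewrite normr0.
have [c0 s0] : cosint f t0 = 0 /\ sinint f t0 = 0 by apply: f_supp; rewrite ger0_norm.
have e : `|2 * pi * (r%:R / N%:R) - 2 * pi * t0| * A * int_oneDsqrV R <= L * b / N%:R.
  rewrite -mulrBr normrM (ger0_norm (_ : 0 <= 2 * pi)) ?mulr_ge0 ?pi_ge0 //.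
  rewrite -mulrA -/Bc mulrAC -/L -mulrA ler_wpM2l ?lipschitz_cst_ge0 //.
  rewrite ltr0_norm ?subr_lt0 // opprB ler_pdivlMr // mulrBl divfK ?gt_eqF //.
  by rewrite mulrC.
split; apply: le_trans e.
  by have := cosint_lip (r%:R / N%:R) t0 nf; rewrite c0 subr0.
by have := sinint_lip (r%:R / N%:R) t0 nf; rewrite s0 subr0.
Qed.

(** The critical frequency N - 2e; the subtraction is not truncated once d >= 10, by [edge_eq]. *)
Let edge d := (d.-1 - 2 * odd_mult p d)%N.

Lemma edge_eq d : (10 <= d)%N -> d.-1 = (edge d + 2 * odd_mult p d)%N.
Proof.
move=> d10; rewrite /edge subnK //; apply: leq_trans (odd_mult_bound d (prime_gt0 p_prime)) _.
have : (d.-1 %/ p <= d.-1 %/ 3)%N by apply: leq_div2l; lia.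
by lia.
Qed.

(** Frequencies k >= [edge d] + 2 thus fall outside the support after division by N; only k =
    [edge d] + 1 escapes both this and the arithmetic bound. *)
Lemma edge_ge d : (10 <= d)%N -> d.-1%:R * (1 - p%:R^-1) <= (edge d)%:R + 2 :> R.
Proof.
move=> d10; have pR : 0 < p%:R :> R by rewrite ltr0n prime_gt0.
have h := odd_mult_bound d (prime_gt0 p_prime).
rewrite mulrBr mulr1 {1}(edge_eq d10) natrD -addrA lerD2l lerBlDr.
apply: le_trans (_ : (d.-1 %/ p + 2)%:R <= _); first by rewrite ler_nat.
by rewrite natrD addrC lerD2l ler_pdivlMr // -natrM ler_nat leq_trunc_div.
Qed.

Lemma sum_even (g : nat -> R) M :
  \sum_(1 <= k < (2 * M).+1) (g k * (if odd k then 0 else 1)) = \sum_(1 <= s < M.+1) g (2 * s)%N.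
Proof.
elim: M => [|M IH]; first by rewrite muln0 !big_geq.
rewrite [RHS]big_nat_recr //= -IH mulnS add2n big_nat_recr //= big_nat_recr //=.
by rewrite mul2n odd_double /= mulr0 addr0 mulr1.
Qed.

(** The family enters only through its averaged cosine and sine moments, and d0 is chosen before it:
    this secures uniformity in q. *)
Lemma average_limit (eps : R) : 0 < eps -> exists d0 : nat, forall d, (d0 <= d)%N -> odd d ->
  forall (T : finType) (S : {set T}) (theta : T -> 'I_d.-1 -> R), (0 < #|S|)%N ->
  (forall r, (0 < r <= edge d)%N ->
    let b := (r%:R + 2) * (9 / 10) ^+ r + r%:R * (9 / 10) ^+ (edge d - r) : R in
    `|\sum_(c in S) \sum_(i < d.-1) cos (r%:R * (2 * pi * theta c i))
       + #|S|%:R * (if odd r then 0 else 1)| <= #|S|%:R * b /\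
    `|\sum_(c in S) \sum_(i < d.-1) sin (r%:R * (2 * pi * theta c i))| <= #|S|%:R * b) ->
  `|#|S|%:R^-1 * \sum_(c in S) \sum_(i < d.-1)
       sumZ (fun k : int => f (d.-1%:R * (theta c i + k%:~R)))
     - \int[mu]_(t in setT) (f t * sinc_kernel t)| < eps.
Proof.
move=> e0; set I := \int[mu]_(t in setT) _.
have e2 : 0 < eps / 2 by rewrite divr_gt0.
(* One factor 2 from the Poisson formula, one from having a cosine and a sine sum. *)
pose K : R := 4 * ((Bc + L) * 110 + 2 * L).
have K0 : 0 <= K by have := decay_cst_ge0; have := lipschitz_cst_ge0; rewrite /K; lra.
have /cvgrPdist_lt/(_ _ e2) [M0 _ hM0] := sinc_integral_cvg nf.
pose d1 := (Num.truncn (K / (eps / 2))).+1.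
(* The first bound places M - 1 beyond M0 for the Riemann sum; the second gives N >= d1 and d >=
   10. *)
exists (maxn (2 * M0 + 4) (d1 + 10)) => d; rewrite geq_max => /andP[dM0 dd1] od.
set N := d.-1; pose M := d./2.
have d10 : (10 <= d)%N by lia.
have NM : N = (2 * M)%N by rewrite /N /M; lia.
have N0 : (0 < N)%N by rewrite /N; lia.
have d1N : (d1 <= N)%N by rewrite /N; lia.
have M1 : M = M.-1.+1 by rewrite /M; lia.
have MM0 : (M0 <= M.-1)%N by rewrite /M; lia.
move=> T S theta S0 hS.
have NR : 0 < N%:R :> R by rewrite ltr0n.
have SR : 0 < #|S|%:R :> R by rewrite ltr0n.
have KN : K / N%:R < eps / 2.
  rewrite ltr_pdivrMr // mulrC -ltr_pdivrMr //.
  apply: lt_le_trans (_ : d1%:R <= _); last by rewrite ler_nat.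
  exact: truncnS_gt.
pose C k := cosint f (k%:R / N%:R); pose D k := sinint f (k%:R / N%:R).
pose ac k := #|S|%:R^-1 * \sum_(c in S) \sum_(i < N) cos (k%:R * (2 * pi * theta c i)).
pose as_ k := #|S|%:R^-1 * \sum_(c in S) \sum_(i < N) sin (k%:R * (2 * pi * theta c i)).
pose dl k : R := if odd k then 0 else 1.
have bl k : (N <= k)%N -> cosint f (k%:R / N%:R) = 0 /\ sinint f (k%:R / N%:R) = 0.
  move=> Nk; apply: f_supp; rewrite ger0_norm ?divr_ge0 ?ler0n //.
  apply: le_trans (_ : 1 <= _); first by rewrite gerBl invr_ge0 ler0n.
  by rewrite ler_pdivlMr // mul1r ler_nat.
have avgE : #|S|%:R^-1 * \sum_(c in S) \sum_(i < N)
      sumZ (fun k : int => f (N%:R * (theta c i + k%:~R)))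
   = cosint f 0 + 2 / N%:R * \sum_(1 <= k < N.+1) (C k * ac k + D k * as_ k).
  have S1 : #|S|%:R != 0 :> R by rewrite gt_eqF.
  have N1 : N%:R != 0 :> R by rewrite gt_eqF.
  have e1 c i : sumZ (fun k : int => f (N%:R * (theta c i + k%:~R)))
      = N%:R^-1 * cosint f 0 + 2 / N%:R * \sum_(1 <= k < N.+1)
         (C k * cos (k%:R * (2 * pi * theta c i)) + D k * sin (k%:R * (2 * pi * theta c i))).
    by rewrite -[LHS](mulKf N1) (poisson_summation (theta c i) nf N0 bl) /poisson_sum mulrDr; congr (_ + _); rewrite mulrA [_^-1 * 2]mulrC.
  have e3 c : \sum_(i < N) sumZ (fun k : int => f (N%:R * (theta c i + k%:~R)))
      = cosint f 0 + 2 / N%:R * \sum_(1 <= k < N.+1)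
         (C k * (\sum_(i < N) cos (k%:R * (2 * pi * theta c i)))
          + D k * (\sum_(i < N) sin (k%:R * (2 * pi * theta c i)))).
    rewrite (eq_bigr _ (fun i _ => e1 c i)) big_split /=; congr (_ + _).
      by rewrite sumr_const card_ord -[LHS]mulr_natl mulrA mulfV // mul1r.
    rewrite -mulr_sumr; congr (_ * _); rewrite exchange_big /=; apply: eq_bigr => k _.
    by rewrite big_split /= -!mulr_sumr.
  rewrite (eq_bigr _ (fun c _ => e3 c)) big_split /= mulrDr; congr (_ + _).
    by rewrite sumr_const -[X in _ * X = _]mulr_natl mulrA mulVf // mul1r.
  rewrite -mulr_sumr mulrCA; congr (_ * _); rewrite exchange_big /= mulr_sumr.
  apply: eq_bigr => k _; rewrite big_split /= -!mulr_sumr /ac /as_.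
  by rewrite mulrDr !mulrA ![#|S|%:R^-1 * _]mulrC.
(* With N = 2M, the even frequencies 2s/N are the nodes s/M of the Riemann sum in
   [sinc_integral_cvg]. *)
have mainE : 2 / N%:R * \sum_(1 <= k < N.+1) (C k * dl k)
    = M%:R^-1 * \sum_(1 <= s < M.+1) cosint f (s%:R / M%:R).
  have MR : M%:R != 0 :> R by rewrite M1 pnatr_eq0.
  rewrite NM sum_even natrM; congr (_ * _); first by field.
  by apply: eq_bigr => s _; rewrite /C NM !natrM; congr (cosint f _); field.
have m2 := edge_ge d10; rewrite -/N in m2.
have mN : (edge d <= N)%N by rewrite /edge /N leq_subr.
have zT (g : R -> R) k (z : R) : (forall x, `|g x| <= 1) -> `|z| <= 1 ->
    `|#|S|%:R^-1 * \sum_(c in S) \sum_(i < N) g (k%:R * (2 * pi * theta c i)) + z| <= N%:R + 1.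
  move=> g1 z1; apply: le_trans (ler_normD _ _) _; apply: lerD => //.
  rewrite normrM normfV (gtr0_norm SR) ler_pdivrMl //.
  apply: le_trans (ler_norm_sum _ _ _) _.
  apply: le_trans (_ : \sum_(c in S) N%:R <= _); last by rewrite sumr_const mulr_natl.
  apply: ler_sum => c _; apply: le_trans (ler_norm_sum _ _ _) _.
  apply: le_trans (_ : \sum_(i < N) 1 <= _); first by apply: ler_sum => i _; exact: g1.
  by rewrite sumr_const card_ord.
have edgeC k : (edge d < k)%N -> N%:R * (1 - p%:R^-1) - k%:R <= 1 :> R.
  move=> mk; have : (edge d).+1%:R <= k%:R :> R by rewrite ler_nat.
  by rewrite -natr1; lra.
have zeroC k : ((edge d).+1 < k)%N -> C k = 0 /\ D k = 0.
  move=> mk; apply: f_supp; rewrite ger0_norm ?divr_ge0 ?ler0n // ler_pdivlMr // mulrC.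
  by apply: le_trans m2 _; rewrite -natrD ler_nat addn2.
have nearC k : (0 < k <= edge d)%N -> N%:R * (1 - p%:R^-1) - k%:R <= (edge d - k)%N%:R + 2 :> R.
  by move=> /andP[_ km]; rewrite natrB //; lra.
have b1 : `|\sum_(1 <= k < N.+1) C k * (ac k + dl k)| <= (Bc + L) * 110 + 2 * L.
  apply: (weighted_sum_bound (m := edge d)) => //; rewrite ?decay_cst_ge0 ?lipschitz_cst_ge0 //.
  - by move=> k _; exact: cosint_bound.
  - by move=> k km; case: (near_edge_bound N0 _ (nearC k km)); rewrite ?addr_ge0 ?ler0n.
  - by case: (near_edge_bound N0 ler01 (edgeC _ (ltnSn _))); rewrite mulr1.
  - by move=> k mk; case: (zeroC k mk).
  - move=> k km; have [h _] := hS k km; rewrite /ac /dl.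
    rewrite -(ler_pM2l SR) -{1}(gtr0_norm SR) -normrM mulrDr mulrA mulfV ?gt_eqF // mul1r.
    exact: h.
  - by move=> k; apply: zT => [x|]; [exact: cos_max|rewrite /dl; case: ifP; rewrite ?normr0 ?normr1].
have b2 : `|\sum_(1 <= k < N.+1) D k * as_ k| <= (Bc + L) * 110 + 2 * L.
  apply: (weighted_sum_bound (m := edge d)) => //; rewrite ?decay_cst_ge0 ?lipschitz_cst_ge0 //.
  - by move=> k _; exact: sinint_bound.
  - by move=> k km; case: (near_edge_bound N0 _ (nearC k km)); rewrite ?addr_ge0 ?ler0n.
  - by case: (near_edge_bound N0 ler01 (edgeC _ (ltnSn _))); rewrite mulr1.
  - by move=> k mk; case: (zeroC k mk).
  - move=> k km; have [_ h] := hS k km; rewrite /as_.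
    rewrite -(ler_pM2l SR) -{1}(gtr0_norm SR) -normrM mulrA mulfV ?gt_eqF // mul1r.
    exact: h.
  - by move=> k; rewrite -[as_ k]addr0; apply: zT => [x|]; [exact: sin_max|rewrite normr0].
rewrite avgE.
have -> : \sum_(1 <= k < N.+1) (C k * ac k + D k * as_ k)
    = \sum_(1 <= k < N.+1) C k * (ac k + dl k) + \sum_(1 <= k < N.+1) D k * as_ k
      - \sum_(1 <= k < N.+1) (C k * dl k).
  by rewrite -big_split -sumrB /=; apply: eq_bigr => k _; ring.
rewrite mulrBr mainE addrA.
have hM : `|I - (cosint f 0 - M%:R^-1 * \sum_(1 <= s < M.+1) cosint f (s%:R / M%:R))| < eps / 2.
  by rewrite M1; exact: hM0.
move: b1 b2 hM; set s1 := \sum_(1 <= k < N.+1) _; set s2 := \sum_(1 <= k < N.+1) _.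
set w := M%:R^-1 * _ => b1 b2 hM.
have -> : cosint f 0 + 2 / N%:R * (s1 + s2) - w - I = 2 / N%:R * (s1 + s2) - (I - (cosint f 0 - w)) by ring.
apply: le_lt_trans (ler_normB _ _) _; rewrite [ltRHS]splitr; apply: ler_ltD => //.
apply: le_trans (ltW KN); rewrite normrM (ger0_norm (_ : 0 <= 2 / N%:R)) ?divr_ge0 ?ler0n //.
rewrite mulrAC ler_pM2r ?invr_gt0 //.
apply: le_trans (ler_wpM2l _ (ler_normD _ _)) _ => //; rewrite /K; lra.
Qed.

End AnalyticCore.


(** * Complex test functions and the final estimate *)

Local Open Scope complex_scope.

Lemma fourier_reE (R : realType) (f g : R -> R) A B tau : nice f A -> nice g B ->
  fourier_re f g tau = cosint f tau + sinint g tau.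
Proof.
move=> nf ng; rewrite /fourier_re RintegralD //.
- exact: integrable_mulcos nf.
- exact: integrable_mulsin ng.
Qed.

Lemma fourier_imE (R : realType) (f g : R -> R) A B tau : nice f A -> nice g B ->
  fourier_im f g tau = cosint g tau - sinint f tau.
Proof.
move=> nf ng; rewrite /fourier_im RintegralB //.
- exact: integrable_mulcos ng.
- exact: integrable_mulsin nf.
Qed.

Lemma cosintN (R : realType) (f : R -> R) tau : cosint f (- tau) = cosint f tau.
Proof. by apply: eq_Rintegral => t _; rewrite mulrN mulNr cosN. Qed.

Lemma sinintN (R : realType) (f : R -> R) A tau : nice f A -> sinint f (- tau) = - sinint f tau.
Proof.
move=> nf; rewrite /sinint -[RHS]mulN1r -RintegralZl //; last exact: integrable_mulsin nf.
by apply: eq_Rintegral => t _; rewrite mulrN mulNr sinN mulrN mulN1r.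
Qed.

Lemma average_complexE (R : realType) (T : finType) (S : {set T}) (N : nat)
    (x y : T -> 'I_N -> R) (a b : R) :
  #|S|%:R^-1 * \sum_(c in S) \sum_(i < N) (x c i +i* y c i) - (a +i* b) =
  (#|S|%:R^-1 * (\sum_(c in S) \sum_(i < N) x c i) - a) +i*
  (#|S|%:R^-1 * (\sum_(c in S) \sum_(i < N) y c i) - b).
Proof.
have -> : #|S|%:R^-1 = real_complex R #|S|%:R^-1 by rewrite fmorphV rmorph_nat.
have -> : \sum_(c in S) \sum_(i < N) (x c i +i* y c i) =
    (\sum_(c in S) \sum_(i < N) x c i) +i* (\sum_(c in S) \sum_(i < N) y c i).
  apply/eqP; rewrite eq_complex Re_sum Im_sum; apply/andP; split; apply/eqP => /=.
    by apply: eq_bigr => c _; rewrite Re_sum.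
  by apply: eq_bigr => c _; rewrite Im_sum.
by apply/eqP; rewrite eq_complex /= !mul0r subr0 addr0 !eqxx.
Qed.

Theorem theorem2 (R : realType) (p : nat) (p_prime : prime p) (p_gt2 : (2 < p)%N)
  (psi : 'F_p -> R[i])
  (psi_add : forall a b : 'F_p, psi (a + b) = psi a * psi b)
  (psi_neq0 : forall a : 'F_p, psi a != 0)
  (psi_nontriv : exists a : 'F_p, psi a != 1)
  (Phir Phii : R -> R) (Phir_schwartz : schwartz Phir) (Phii_schwartz : schwartz Phii)
  (Phi_supp : forall tau : R, 1 - (p%:R)^-1 <= `|tau| ->
                fourier_re Phir Phii tau = 0 /\ fourier_im Phir Phii tau = 0) :
  forall eps : R, 0 < eps ->
  exists d0 : nat, forall d : nat, (d0 <= d)%N -> coprime d (2 * p) ->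
  forall (F : finFieldType), p \in [pchar F] ->
  (* E r is a finite field with q^(r+1) elements extending F = F_q via iota r *)
  forall (E : nat -> finFieldType) (iota : forall r : nat, {rmorphism F -> E r}),
  (forall r : nat, #|E r| = (#|F| ^ r.+1)%N) ->
  (* theta f = the normalized angles of the N = d-1 inverse zeros of L(u, f, psi):
     L(u,f,psi) = prod_i (1 - q^(1/2) e^(2 pi i theta_i) u), i.e. (taking log)
     S_r(f) = - sum_i (q^(1/2) e^(2 pi i theta_i))^r for all r >= 1. *)
  forall theta : {ffun 'I_d.+1 -> F} -> 'I_d.-1 -> R,
  (forall c, c \in AS0odd p F d -> forall r : nat,
     char_sum (iota r) psi (ASpoly c) =
     - \sum_(i < d.-1) ((Num.sqrt (#|F|%:R : R))%:C * expi (theta c i)) ^+ r.+1)%C ->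
  `| (#|AS0odd p F d|%:R)^-1 *
       \sum_(c in AS0odd p F d) W1 Phir Phii (theta c)
     - sinc_integral Phir Phii | < eps%:C.
Proof.
move=> eps eps0.
have pR : 0 < p%:R :> R by rewrite ltr0n prime_gt0.
have [Ar nr] := schwartz_nice Phir_schwartz; have [Ai ni] := schwartz_nice Phii_schwartz.
(* The transform mixes the two parts of Phi. The support condition is symmetric in tau while
   [cosint] is even and [sinint] odd, so the values at tau and -tau together separate all four
   integrals. *)
have tau0 (tau : R) : 1 - p%:R^-1 <= `|tau| ->
    [/\ cosint Phir tau = 0, sinint Phir tau = 0, cosint Phii tau = 0 & sinint Phii tau = 0].
  move=> h; have [] := Phi_supp tau h; have [] : fourier_re Phir Phii (- tau) = 0 /\ fourier_im Phir Phii (- tau) = 0.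
    by apply: Phi_supp; rewrite normrN.
  rewrite !(fourier_reE _ nr ni) !(fourier_imE _ nr ni) !cosintN (sinintN _ nr) (sinintN _ ni).
  by split; lra.
have suppr (tau : R) : 1 - p%:R^-1 <= `|tau| -> cosint Phir tau = 0 /\ sinint Phir tau = 0.
  by move=> /tau0[].
have suppi (tau : R) : 1 - p%:R^-1 <= `|tau| -> cosint Phii tau = 0 /\ sinint Phii tau = 0.
  by move=> /tau0[].
have e2 : 0 < eps / 2 by rewrite divr_gt0.
have [d1 h1] := average_limit p_prime p_gt2 nr suppr e2.
have [d2 h2] := average_limit p_prime p_gt2 ni suppi e2.
exists (maxn 10 (maxn d1 d2)) => d; rewrite !geq_max => /and3P[d10 dd1 dd2].
rewrite coprimeMr coprimen2 => /andP[od cop] F pF E iota cE theta hth.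
pose n := logn p #|F|; have cF : #|F| = (p ^ n)%N by exact: card_pchar.
have n0 : (0 < n)%N.
  rewrite lt0n; apply/negP => /eqP n0; have := card_finNzRing_gt1 F.
  by rewrite cF n0.
have pd : ~~ (p %| d)%N by rewrite -prime_coprime // coprime_sym.
have S0 : (0 < #|AS0odd p F d|)%N.
  by apply: (@card_AS0odd_gt0 p p_prime p_gt2 F F n 1 d) => //; rewrite expn1.
have dm := edge_eq p_prime p_gt2 d10.
set m := (d.-1 - 2 * odd_mult p d)%N in dm.
have q3 : (3 <= p ^ n)%N.
  by apply: leq_trans p_gt2 _; rewrite -{1}(expn1 p) leq_exp2l // prime_gt1.
have hS r : (0 < r <= m)%N ->
    let b := (r%:R + 2) * (9 / 10) ^+ r + r%:R * (9 / 10) ^+ (m - r) : R in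
    `|\sum_(c in AS0odd p F d) \sum_(i < d.-1) cos (r%:R * (2 * pi * theta c i))
       + #|AS0odd p F d|%:R * (if odd r then 0 else 1)| <= #|AS0odd p F d|%:R * b /\
    `|\sum_(c in AS0odd p F d) \sum_(i < d.-1) sin (r%:R * (2 * pi * theta c i))|
       <= #|AS0odd p F d|%:R * b.
  case: r => // r /andP[_ rm] b.
  have cEr : #|E r| = ((p ^ n) ^ r.+1)%N by rewrite cE cF.
  have pE : p \in [pchar (E r)] by rewrite (fmorph_pchar (iota r)).
  apply: (moment_bound p_prime p_gt2 psi_add psi_neq0 psi_nontriv pE n0 cF (ltn0Sn r) cEr od pd).
    by move=> c cS; exact: hth.
  have rd : (r.+1 < d)%N by move: dm rm; lia.
  apply: le_trans (bad_count_bound R q3 (ltn0Sn r) od dm rm); rewrite cF.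
  have sq0 : 0 < (Num.sqrt ((p ^ n)%N%:R : R) ^+ r.+1)^-1.
    by rewrite invr_gt0 exprn_gt0 // sqrtr_gt0 ltr0n (leq_trans _ q3).
  by rewrite (ler_pM2r sq0) ler_nat; apply: card_bad_set.
have {}h1 := h1 d dd1 od _ _ theta S0 hS; have {}h2 := h2 d dd2 od _ _ theta S0 hS.
move: h1 h2; rewrite /sinc_integral /W1.
set I1 := \int[_]_(_ in _) _; set I2 := \int[_]_(_ in _) _.
set X1 := _ * \sum_(c in _) _; set X2 := _ * \sum_(c in _) _ => h1 h2.
rewrite average_complexE.
by apply: norm_complex_le; rewrite [ltRHS]splitr ltrD.
Qed.
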